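(* Let $\mathcal{A}$ be a $W^{*}$-algebra and let $G\in\widehat{\mathcal{M}\Phi}_{-}(l_2(\mathcal{A}))$. Then for every $K\in K(l_2(\mathcal{A}))$ there exists an ($\mathcal{A}$-valued) inner product on $l_2(\mathcal{A})$, equivalent to the initial one, such that the orthogonal complement of $\overline{\operatorname{Im}(G+K)}$ with respect to this new inner product is finitely generated.
   Context: $l_{2}(\mathcal{A})$ is the standard (right) Hilbert $C^{*}$-module over $\mathcal{A}$ of sequences $(a_i)_{i\in\mathbb{N}}$ in $\mathcal{A}$ with $\sum_i a_i^{*}a_i$ norm-convergent. $B(l_2(\mathcal{A}))$ is the set of bounded $\mathcal{A}$-linear (not necessarily adjointable) operators on $l_2(\mathcal{A})$. $K(l_2(\mathcal{A}))$ is the set of all compact, not necessarily adjointable, operators in the sense of Irmatov and Mishchenko: the norm closure in $B(l_2(\mathcal{A}))$ of the operators that factor as bounded $\mathcal{A}$-linear maps through a finitely generated free module $\mathcal{A}^{n}$. A Hilbert module is finitely generated if it is the linear span (over $\mathbb{C}$ and $\mathcal{A}$) of a finite subset. $\tilde\oplus$ denotes the direct sum of closed submodules, not necessarily orthogonal. Two $\mathcal{A}$-valued inner products are equivalent if they induce equivalent norms. $\widehat{\mathcal{M}\Phi}_{-}(l_2(\mathcal{A}))$ is the set of $G\in B(l_2(\mathcal{A}))$ for which there exist closed submodules $M,N,M'$ of $l_2(\mathcal{A})$ such that $l_2(\mathcal{A})=M\tilde\oplus N$, $N$ is finitely generated and $G|_{M'}$ is an isomorphism (bounded $\mathcal{A}$-linear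 bijection) of $M'$ onto $M$. (It is not required that $M'$ be complementable.) *)

(* Defs.v *)
From HB Require Import structures.
From mathcomp Require Import all_boot all_order all_algebra.
From mathcomp Require Import complex.
From mathcomp Require Import all_classical all_reals all_analysis.
Set Implicit Arguments.
Unset Strict Implicit.
Unset Printing Implicit Defensive.
Import Order.TTheory GRing.Theory Num.Theory.
Import numFieldNormedType.Exports.
Local Open Scope classical_set_scope.
Local Open Scope ring_scope.

(* Unital C*-algebras over R[i]; the zero algebra is allowed. The product is a
   field of this mixin because Hierarchy Builder rejects a common extension of
   ringType and normedModType (missing join below numDomainType). It is turned
   into the ring product [*] on every C*-algebra below. *)
HB.mixin Record isCStarAlgebra (R : realType) A
    of CompleteNormedModule R[i] A := {
  cmul : A -> A -> A;
  cone : A;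
  star : A -> A;
  cmulA : associative cmul;
  cmul1l : left_id cone cmul;
  cmul1r : right_id cone cmul;
  cmulDl : left_distributive cmul +%R;
  cmulDr : right_distributive cmul +%R;
  cscaleAl : forall (c : R[i]) (a b : A), c *: (cmul a b) = cmul (c *: a) b;
  cscaleAr : forall (c : R[i]) (a b : A), c *: (cmul a b) = cmul a (c *: b);
  cnorm_mul : forall a b : A, `|cmul a b| <= `|a| * `|b|;
  starK : involutive star;
  starD : {morph star : a b / a + b};
  starZ : forall (c : R[i]) (a : A), star (c *: a) = c^* *: star a;
  star_cmul : forall a b : A, star (cmul a b) = cmul (star b) (star a);
  cstar_identity : forall a : A, `|cmul (star a) a| = `|a| ^+ 2
}.

#[short(type="cstarAlgType")]
HB.structure Definition CStarAlgebra (R : realType) :=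
  {A of isCStarAlgebra R A & CompleteNormedModule R[i] A}.

HB.instance Definition _ (R : realType) (A : cstarAlgType R) :=
  GRing.Zmodule_isPzRing.Build A (@cmulA R A) (@cmul1l R A) (@cmul1r R A)
    (@cmulDl R A) (@cmulDr R A).

(* A complex Hilbert space is a complete normed module over R[i] together with
   a dot product (linear in the first variable, conjugate-linear in the second)
   that induces the norm. *)
Definition hilbert_dot (R : realType) (H : completeNormedModType R[i])
    (dot : {dot H for Num.conj}) : Prop :=
  forall x : H, `|x| ^+ 2 = dot x x.

(* Isometric unital *-representation of A by bounded operators on H. *)
Record isometric_star_rep (R : realType) (A : cstarAlgType R)
    (H : completeNormedModType R[i]) (dot : {dot H for Num.conj})
    (pi : A -> {linear H -> H}) : Prop := {
  rep_linear : forall x : H, linear (fun a => pi a x);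
  rep1 : forall x : H, pi 1 x = x;
  repM : forall a b x, pi (a * b) x = pi a (pi b x);
  rep_star : forall a x y, dot (pi a x) y = dot x (pi (star a) y);
  rep_isometric : forall a (c : R[i]), 0 <= c ->
    (`|a| <= c <-> forall x, `|pi a x| <= c * `|x|)
}.

(* pi(A) is closed in B(H) for the weak operator topology. *)
Definition weakly_closed_range (R : realType) (A : cstarAlgType R)
    (H : completeNormedModType R[i]) (dot : {dot H for Num.conj})
    (pi : A -> {linear H -> H}) : Prop :=
  forall T : {linear H -> H}, continuous T ->
    (forall (n : nat) (x y : 'I_n -> H) (e : R[i]), 0 < e ->
      exists a : A, forall k, `|dot (T (x k) - pi a (x k)) (y k)| < e) ->
    exists a : A, forall x, T x = pi a x.

(* A W*-algebra is a C*-algebra isomorphic to a von Neumann algebra, i.e. to a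
   weakly closed unital *-subalgebra of B(H) for some Hilbert space H. *)
Definition wstar_algebra (R : realType) (A : cstarAlgType R) : Prop :=
  exists (H : completeNormedModType R[i]) (dot : {dot H for Num.conj})
         (pi : A -> {linear H -> H}),
    [/\ hilbert_dot dot, isometric_star_rep dot pi
      & weakly_closed_range dot pi].

Section HilbertModules.
Variables (R : realType) (A : cstarAlgType R).
Local Notation C := R[i].
Local Notation seqA := (nat -> A).

Definition cstar_nneg (a : A) : Prop := exists b : A, a = star b * b.

(* Right action of A on families. Since A is unital and
   [ract x (c *: 1) = c *: x], A-linear maps are automatically C-linear. *)
Definition ract (I : Type) (x : I -> A) (a : A) : I -> A := fun i => x i * a.

Definition ip_norm (X : Type) (ip : X -> X -> A) (x : X) : C :=
  sqrtC `|ip x x|.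

(* l_2(A) is the subset [l2] of the space of all sequences in A; operators on
   l_2(A) are represented by functions on sequences, whose values outside
   [l2] are irrelevant. *)
Definition l2 : set seqA :=
  [set x | cvgn (series (fun i => star (x i) * x i))].

Definition l2_ip (x y : seqA) : A := limn (series (fun i => star (x i) * y i)).

Definition l2_norm : seqA -> C := ip_norm l2_ip.

Definition free_ip (n : nat) (x y : 'I_n -> A) : A :=
  \sum_(i < n) star (x i) * y i.

Definition free_norm (n : nat) : ('I_n -> A) -> C := ip_norm (@free_ip n).

Definition bounded_Alinear (I J : Type)
    (X : set (I -> A)) (nX : (I -> A) -> C)
    (Y : set (J -> A)) (nY : (J -> A) -> C) (f : (I -> A) -> (J -> A)) : Prop :=
  [/\ forall x, X x -> Y (f x),
      forall x y, X x -> X y -> f (x + y) = f x + f y,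
      forall x a, X x -> f (ract x a) = ract (f x) a
    & exists c : C, forall x, X x -> nY (f x) <= c * nX x].

Definition B_l2 (G : seqA -> seqA) : Prop :=
  bounded_Alinear l2 l2_norm l2 l2_norm G.

Definition factors_free (F : seqA -> seqA) : Prop :=
  exists (n : nat) (S : seqA -> ('I_n -> A)) (T : ('I_n -> A) -> seqA),
    [/\ bounded_Alinear l2 l2_norm [set: 'I_n -> A] (@free_norm n) S,
        bounded_Alinear [set: 'I_n -> A] (@free_norm n) l2 l2_norm T
      & forall x, l2 x -> F x = T (S x)].

(* K(l_2(A)): operator-norm closure in B(l_2(A)) of the operators factoring
   through some A^n. *)
Definition K_l2 (K : seqA -> seqA) : Prop :=
  B_l2 K /\
  forall e : C, 0 < e -> exists F : seqA -> seqA,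
    factors_free F /\
    forall x, l2 x -> l2_norm (K x - F x) <= e * l2_norm x.

Definition l2_closure (S : set seqA) : set seqA :=
  [set x | l2 x /\ forall e : C, 0 < e -> exists2 y, S y & l2_norm (x - y) < e].

Definition closed_submodule (M : set seqA) : Prop :=
  [/\ M `<=` l2, M 0, forall x y, M x -> M y -> M (x + y),
      forall x a, M x -> M (ract x a) & l2_closure M `<=` M].

Definition fin_span (n : nat) (v : 'I_n -> seqA) : set seqA :=
  [set x | exists (c : 'I_n -> C) (a : 'I_n -> A),
     x = \sum_(i < n) (c i *: v i + ract (v i) (a i))].

Definition finitely_generated (M : set seqA) : Prop :=
  exists (n : nat) (v : 'I_n -> seqA), M = fin_span v.

Definition l2_direct_sum (M N : set seqA) : Prop :=
  (forall x, l2 x <-> exists2 m, M m & exists2 n, N n & x = m + n) /\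
  M `&` N = [set 0].

(* By the open mapping theorem, the restriction of a bounded A-linear operator
   that is a bijection between closed submodules is an isomorphism. *)
Definition MPhi_minus_hat (G : seqA -> seqA) : Prop :=
  B_l2 G /\
  exists M N M' : set seqA,
    [/\ closed_submodule M, closed_submodule N & closed_submodule M'] /\
    [/\ l2_direct_sum M N, finitely_generated N & set_bij M' M G].

Record l2_inner_product (ip : seqA -> seqA -> A) : Prop := {
  ipDr : forall x y z, l2 x -> l2 y -> l2 z -> ip x (y + z) = ip x y + ip x z;
  ip_ract : forall x y a, l2 x -> l2 y -> ip x (ract y a) = ip x y * a;
  ip_star : forall x y, l2 x -> l2 y -> star (ip x y) = ip y x;
  ip_nneg : forall x, l2 x -> cstar_nneg (ip x x);
  ip_definite : forall x, l2 x -> ip x x = 0 -> x = 0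
}.

Definition equivalent_ip (ip1 ip2 : seqA -> seqA -> A) : Prop :=
  exists c d : C, forall x, l2 x ->
    ip_norm ip1 x <= c * ip_norm ip2 x /\ ip_norm ip2 x <= d * ip_norm ip1 x.

Definition orthogonal_complement (ip : seqA -> seqA -> A) (S : set seqA) :
    set seqA :=
  [set y | l2 y /\ forall x, S x -> ip x y = 0].

End HilbertModules.

(* Main.v *)
(* Write D = G + K and let q_m be the projection of l_2(A) that kills the first
   m coordinates.  Since N is finitely generated and K is compact, both q_m
   restricted to the unit ball of N and q_m K tend to 0 in norm, although K q_m
   need not.  Hence, composing D with the map x |-> (G|M')^-1 (component of x in
   M), which is bounded by the open mapping theorem, and compressing by q_m, one
   gets 1 - E on q_m l_2(A) with |E| <= 1/2 for m large.  A Neumann series then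
   shows that Im D contains the graph {x + Theta x : x in q_m l_2(A)} of a
   bounded map Theta from q_m l_2(A) to A^m.  Transporting the standard inner
   product along the shear x + z |-> x + Theta x + z, which fixes A^m pointwise,
   makes the orthogonal complement of Im D equal to the annihilator in A^m of
   some subset.

   In a W*-algebra such an annihilator is p A^m for a projection p in M_m(A):
   represent A on a Hilbert space H; the projection of H^m onto the common
   kernel of the functionals is a strong limit of matrices over A (a minimizing
   sequence), so its entries lie in A, which is weakly closed.  The faithful
   representation also gives the order properties of A, such as Cauchy-Schwarz
   and the monotonicity of norms of sums of squares. *)
Require Import Defs.
From HB Require Import structures.
From mathcomp Require Import all_boot all_order all_algebra.
From mathcomp Require Import complex ring lra zify.
From mathcomp Require Import all_classical all_reals all_analysis.
Import Order.TTheory GRing.Theory Num.Theory.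
Import numFieldNormedType.Exports.
Local Open Scope classical_set_scope.
Local Open Scope ring_scope.
Set Implicit Arguments.
Unset Strict Implicit.
Unset Printing Implicit Defensive.

(** Neither K nor Theta has to be adjointable, and this dictates the change of inner product. For
    the original one, the complement of the graph of Theta consists of vectors z - Theta^* z, for
    those z in A^m for which Theta^* z exists in l_2(A), and nothing makes this set finitely
    generated. After the shear the graph becomes q_m l_2(A), whose complement is exactly A^m; every
    other vector of the range only adds equations inside A^m. Over a general C*-algebra the
    solutions of such equations need not be finitely generated: in C[0,1] the annihilator of a
    function with support [0,1/2] is not.

    Smallness of q_m on bounded parts of N requires bounded coefficients with respect to the
    generators v_i of N. The open mapping theorem is therefore proved for (w, a) |-> G w + sum v_i
    a_i from M' + A^n onto l_2(A), which bounds w and the coefficients together.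

    Positivity of an inner product has to be exhibited as b^* b, so a square root inside A is
    constructed by iteration. *)

(** * Real-valued norms and sequential limits *)

Section RealNorm.
Variables (R : realType) (V : normedModType R[i]).
Implicit Types (u v w : V) (s t : nat -> V).

(** Norms of modules over [R[i]] lie in [R[i]]; a real value gives access to infima, [Num.sqrt] and
    linear arithmetic over [R]. *)
Definition rnorm v : R := complex.Re `|v|.

Lemma rnormE v : `|v| = (rnorm v)%:C%C.
Proof. by rewrite /rnorm RRe_real // ger0_real. Qed.

Lemma rnorm_ge0 v : 0 <= rnorm v.
Proof. by rewrite -ler0c -rnormE. Qed.

Lemma rnorm_le v (c : R) : (`|v| <= c%:C%C) = (rnorm v <= c).
Proof. by rewrite rnormE lecR. Qed.

Lemma rnorm_lt v (c : R) : (`|v| < c%:C%C) = (rnorm v < c).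
Proof. by rewrite rnormE ltcR. Qed.

Lemma rnormD u v : rnorm (u + v) <= rnorm u + rnorm v.
Proof. by rewrite -rnorm_le rmorphD /= -!rnormE ler_normD. Qed.

Lemma rnormN v : rnorm (- v) = rnorm v.
Proof. by rewrite /rnorm normrN. Qed.

Lemma rnormB u v : rnorm (u - v) <= rnorm u + rnorm v.
Proof. by rewrite -(rnormN v) rnormD. Qed.

Lemma rnorm_distC u v : rnorm (u - v) = rnorm (v - u).
Proof. by rewrite -rnormN opprB. Qed.

Lemma rnorm0 : rnorm 0 = 0 :> R.
Proof. by rewrite /rnorm normr0. Qed.

Lemma rnorm0_eq0 v : rnorm v = 0 -> v = 0.
Proof. by move=> v0; apply/normr0_eq0; rewrite rnormE v0. Qed.

Lemma rnormZ (r : R) v : rnorm (r%:C%C *: v) = `|r| * rnorm v.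
Proof. by rewrite /rnorm normrZ rnormE normc_def /= expr0n addr0 sqrtr_sqr mul0r subr0. Qed.

Lemma rnorm_dist3 u v w : rnorm (u - w) <= rnorm (u - v) + rnorm (v - w).
Proof. by rewrite (le_trans _ (rnormD _ _)) // addrA subrK. Qed.

Definition slim s v : Prop :=
  forall e : R, 0 < e -> exists N, forall n, (N <= n)%N -> rnorm (s n - v) < e.

Definition scauchy s : Prop :=
  forall e : R, 0 < e -> exists N, forall m n, (N <= m)%N -> (N <= n)%N ->
    rnorm (s m - s n) < e.

Lemma slimP s v : slim s v <-> s @ \oo --> v.
Proof.
split=> [sv|/cvgrPdist_lt sv e e0].
  apply/cvgrPdist_lt => e e0.
  have er : e \is Num.real by rewrite ger0_real // ltW.
  have /complex_realP[k ek] := er.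
  have [|N NP] := sv k; first by rewrite -ltcR -ek.
  exists N => // n /= Nn.
  by rewrite distrC ek rnorm_lt NP.
have [|N _ NP] := sv e%:C%C; first by rewrite ltcR.
by exists N => n Nn; rewrite -rnorm_lt distrC; exact: NP.
Qed.

Lemma slim_unique s v w : slim s v -> slim s w -> v = w.
Proof.
move=> /slimP sv /slimP sw.
exact: (cvg_unique _ sv sw).
Qed.

Lemma slim_cvgn s v : slim s v -> cvgn s.
Proof. by move=> /slimP sv; apply/cvg_ex; exists v. Qed.

Lemma cvgn_slim s : cvgn s -> slim s (limn s).
Proof. by move=> sc; apply/slimP. Qed.

Lemma slim_cst v : slim (fun=> v) v.
Proof. by move=> e e0; exists 0%N => n _; rewrite subrr rnorm0. Qed.

Lemma slimD s t v w : slim s v -> slim t w -> slim (fun n => s n + t n) (v + w).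
Proof. by move=> /slimP sv /slimP tw; apply/slimP; exact: cvgD. Qed.

Lemma slim_le s v (c : R) : slim s v ->
  (exists N, forall n, (N <= n)%N -> rnorm (s n) <= c) -> rnorm v <= c.
Proof.
move=> sv [N NP]; apply/ler_addgt0Pr => e e0.
have [N' N'P] := sv e e0.
rewrite -(subKr (s (maxn N N')) v) (le_trans (rnormB _ _)) // lerD //.
  by rewrite NP // leq_maxl.
by rewrite ltW // N'P // leq_maxr.
Qed.

Lemma slim_scauchy s v : slim s v -> scauchy s.
Proof.
move=> sv e e0; have [|N NP] := sv (e / 2); first by rewrite divr_gt0.
exists N => m n Nm Nn; rewrite (le_lt_trans (rnorm_dist3 _ v _)) //.
by rewrite (splitr e) ltrD ?NP // rnorm_distC NP.
Qed.

End RealNorm.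

Lemma slim_image (R : realType) (V W : normedModType R[i]) (f : V -> W) (c : R)
    (s : nat -> V) (v : V) :
  (forall x y, rnorm (f x - f y) <= c * rnorm (x - y)) ->
  slim s v -> slim (fun n => f (s n)) (f v).
Proof.
move=> fc sv e e0.
have c0 : 0 < `|c| + 1 by rewrite ltr_wpDl.
have [|N NP] := sv (e / (`|c| + 1)); first by rewrite divr_gt0.
exists N => n Nn; rewrite (le_lt_trans (fc _ _)) //.
rewrite (@le_lt_trans _ _ ((`|c| + 1) * rnorm (s n - v))) //.
  by rewrite ler_wpM2r ?rnorm_ge0 // (le_trans (ler_norm _)) // lerDl.
by rewrite mulrC -ltr_pdivlMr // NP.
Qed.

Lemma scauchy_slim (R : realType) (V : completeNormedModType R[i])
    (s : nat -> V) : scauchy s -> exists v, slim s v.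
Proof.
move=> sc; suff : cvgn s by move=> /cvgn_slim; exists (limn s).
apply/cauchy_cvgP/cauchy_ballP => e e0.
have /complex_realP[k ek] : e \is Num.real by rewrite ger0_real // ltW.
have [|N NP] := sc k; first by rewrite -ltcR -ek.
exists (s @` [set n | (N <= n)%N], s @` [set n | (N <= n)%N]).
  by split; exists N => // n /= Nn; exists n.
move=> [_ _] /= [[m Nm <-] [n Nn <-]].
by rewrite -ball_normE /= ek rnorm_lt NP.
Qed.

(** Common core of the Cauchy-Schwarz inequalities below, both for finite families in H and for the
    form of a positive element of A. *)
Lemma discriminant_le (R : realFieldType) (a b c : R) : 0 <= c ->
  (forall t, 0 <= a - 2 * t * b + t ^+ 2 * c) -> b ^+ 2 <= a * c.
Proof.
rewrite le_eqVlt => /orP[/eqP<-|c0] h.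
  rewrite mulr0; have [->|b0] := eqVneq b 0; first by rewrite expr0n.
  (* For [c = 0] the expression is affine in [t] and takes the value -1 here. *)
  have := h ((a + 1) / (2 * b)).
  have -> : 2 * ((a + 1) / (2 * b)) * b = a + 1 by field.
  by lra.
have := h (b / c); rewrite -(ler_pM2r c0) mul0r => hb.
rewrite -subr_ge0 (le_trans hb) // le_eqVlt; apply/orP; left; apply/eqP.
by field; rewrite gt_eqF.
Qed.

Lemma le_of_sqr (R : realDomainType) (b d : R) : 0 <= d -> b ^+ 2 <= d ^+ 2 -> b <= d.
Proof.
move=> d0; apply: contraTT; rewrite -!ltNge => db.
by rewrite ltr_sqr ?nnegrE // (le_trans d0) // ltW.
Qed.

Lemma lt_of_sqr (R : realDomainType) (b d : R) : 0 <= d -> b ^+ 2 < d ^+ 2 -> b < d.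
Proof.
move=> d0; apply: contraTT; rewrite -!leNgt => db.
by rewrite ler_sqr ?nnegrE // (le_trans d0).
Qed.

(** * Norm and involution of a C*-algebra; Gram sums *)

Section CStarNorm.
Variables (R : realType) (A : cstarAlgType R).
Implicit Types a b : A.

Lemma starM a b : star (a * b) = star b * star a.
Proof. exact: star_cmul. Qed.

Lemma starN a : star (- a) = - star a.
Proof.
have := starZ (-1) a; rewrite !scaleN1r => ->.
by rewrite rmorphN rmorph1 scaleN1r.
Qed.

Lemma star0 : star 0 = 0 :> A.
Proof. by have := starZ 0 (0 : A); rewrite rmorph0 !scale0r. Qed.

Lemma star1 : star 1 = 1 :> A.
Proof. by have := starM (star 1) (1 : A); rewrite mulr1 !starK mulr1. Qed.

Lemma star_sum (I : Type) (r : seq I) (P : pred I) (F : I -> A) :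
  star (\sum_(i <- r | P i) F i) = \sum_(i <- r | P i) star (F i).
Proof. by apply: (big_morph _ (@starD _ _) star0). Qed.

Lemma starZr (r : R) a : star (r%:C%C *: a) = r%:C%C *: star a.
Proof. by rewrite starZ /= conj_Creal //; apply/complex_realP; exists r. Qed.

Lemma rnormM a b : rnorm (a * b) <= rnorm a * rnorm b.
Proof. by rewrite -rnorm_le rmorphM /= -!rnormE; exact: cnorm_mul. Qed.

Lemma rnorm_cstar a : rnorm (star a * a) = rnorm a ^+ 2.
Proof.
by apply: complexI; rewrite rmorphXn /= -!rnormE; exact: cstar_identity.
Qed.

(** The C*-identity gives |b|^2 = |b^* b| <= |b^*| |b|; cancel |b| and apply the result to both [a]
    and [star a]. *)
Lemma rnorm_star a : rnorm (star a) = rnorm a.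
Proof.
have key b : rnorm b <= rnorm (star b).
  have [->|b0] := eqVneq (rnorm b) 0; first exact: rnorm_ge0.
  have bp : 0 < rnorm b by rewrite lt_def b0 rnorm_ge0.
  by rewrite -(ler_pM2r bp) -expr2 -rnorm_cstar rnormM.
by apply/le_anti; rewrite key andbT -{2}(starK a) key.
Qed.

Lemma scaler_mull (c : R[i]) a b : (c *: a) * b = c *: (a * b).
Proof. by rewrite -[RHS]/(c *: cmul a b) cscaleAl. Qed.

Lemma scaler_mulr (c : R[i]) a b : a * (c *: b) = c *: (a * b).
Proof. by rewrite -[RHS]/(c *: cmul a b) cscaleAr. Qed.

(** One A-valued form serves partial sums of [l2_ip], blocks of coordinates and [free_ip]. The index
    list is explicit so that monotonicity can be stated by concatenation. *)
Definition gram (I : Type) (r : seq I) (x y : I -> A) : A :=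
  \sum_(i <- r) star (x i) * y i.

Lemma star_gram (I : Type) (r : seq I) (x y : I -> A) :
  star (gram r x y) = gram r y x.
Proof. by rewrite star_sum; apply: eq_bigr => i _; rewrite starM starK. Qed.

End CStarNorm.

(** * Order estimates through a faithful representation *)

Section Representation.
Variables (R : realType) (A : cstarAlgType R).
Variables (H : completeNormedModType R[i]) (dot : {dot H for Num.conj}).
Variable pi : A -> {linear H -> H}.
Hypotheses (hdot : hilbert_dot dot) (hpi : isometric_star_rep dot pi).
Implicit Types (h k u v : H) (a b : A).

(** A real symmetric bilinear form is enough for discriminant arguments, and nothing is lost on the
    diagonal, where [dot v v] is real. *)
Definition rdot u v : R := complex.Re (dot u v).

Lemma rdotDl u v w : rdot (u + v) w = rdot u w + rdot v w.
Proof. by rewrite /rdot linearDl raddfD. Qed.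

Lemma rdotC u v : rdot u v = rdot v u.
Proof.
rewrite /rdot (hermC dot) /= expr0 mul1r.
by case: (dot v u).
Qed.

Lemma rdotDr u v w : rdot u (v + w) = rdot u v + rdot u w.
Proof. by rewrite rdotC rdotDl !(rdotC u). Qed.

Lemma rdotZl (r : R) u v : rdot (r%:C%C *: u) v = r * rdot u v.
Proof.
rewrite /rdot linearZl_LR /=.
by case: (dot u v) => x y /=; rewrite mul0r subr0.
Qed.

Lemma rdotZr (r : R) u v : rdot u (r%:C%C *: v) = r * rdot u v.
Proof. by rewrite rdotC rdotZl rdotC. Qed.

Lemma rdotNl u v : rdot (- u) v = - rdot u v.
Proof. by rewrite -scaleN1r -[in LHS](rmorph1 (real_complex R)) -rmorphN rdotZl mulN1r. Qed.

Lemma rdotBl u v w : rdot (u - v) w = rdot u w - rdot v w.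
Proof. by rewrite rdotDl rdotNl. Qed.

Lemma rdotBr u v w : rdot u (v - w) = rdot u v - rdot u w.
Proof. by rewrite rdotC rdotBl !(rdotC u). Qed.

Lemma rdot0l v : rdot 0 v = 0.
Proof. by rewrite -(subrr v) rdotBl subrr. Qed.

Lemma rdotvv v : rdot v v = rnorm v ^+ 2.
Proof.
apply: complexI; rewrite rmorphXn /= -rnormE hdot /rdot.
by rewrite RRe_real // ger0_real // dnorm_ge0.
Qed.

Lemma rdot_suml (I : Type) (r : seq I) (F : I -> H) v :
  rdot (\sum_(i <- r) F i) v = \sum_(i <- r) rdot (F i) v.
Proof. by apply: (big_morph (rdot^~ v)) => [x y|]; rewrite ?rdotDl ?rdot0l. Qed.

Lemma rep_adj a u v : rdot (pi a u) v = rdot u (pi (star a) v).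
Proof. by rewrite /rdot (rep_star hpi). Qed.

Lemma repD a b h : pi (a + b) h = pi a h + pi b h.
Proof. by have := rep_linear hpi h 1 a b; rewrite !scale1r. Qed.

Lemma repZ (c : R[i]) a h : pi (c *: a) h = c *: pi a h.
Proof.
have rep0 : pi 0 h = 0.
  by have := rep_linear hpi h (-1) 0 0; rewrite scaler0 addr0 scaleN1r addNr.
by have := rep_linear hpi h c a 0; rewrite addr0 rep0 addr0.
Qed.

Lemma rep0 h : pi 0 h = 0.
Proof. by rewrite -(scale0r (0 : A)) repZ scale0r. Qed.

Lemma repB a b h : pi (a - b) h = pi a h - pi b h.
Proof. by rewrite repD -scaleN1r repZ scaleN1r. Qed.

Lemma rep_sum (I : Type) (r : seq I) (F : I -> A) h :
  pi (\sum_(i <- r) F i) h = \sum_(i <- r) pi (F i) h.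
Proof. by apply: (big_morph (fun a => pi a h)) => [x y|]; rewrite ?repD ?rep0. Qed.

Lemma rep_norm a (c : R) : 0 <= c ->
  (rnorm a <= c <-> forall h, rnorm (pi a h) <= c * rnorm h).
Proof.
move=> c0; have c0' : 0 <= c%:C%C by rewrite ler0c.
rewrite -rnorm_le (rep_isometric hpi a c0').
by split=> + h => /(_ h); rewrite (rnormE h) -rmorphM rnorm_le.
Qed.

Lemma rep_norm_le a h : rnorm (pi a h) <= rnorm a * rnorm h.
Proof. by apply: (rep_norm _ (rnorm_ge0 a)).1. Qed.

Lemma rep_faithful a : (forall h, pi a h = 0) -> a = 0.
Proof.
move=> a0; apply/rnorm0_eq0/le_anti; rewrite rnorm_ge0 andbT.
by apply/(rep_norm a (lexx 0)) => h; rewrite a0 rnorm0 mul0r.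
Qed.

Lemma rep_inj a b : (forall h, pi a h = pi b h) -> a = b.
Proof.
move=> ab; apply/eqP; rewrite -subr_eq0; apply/eqP/rep_faithful => h.
by rewrite repB ab subrr.
Qed.

(** The power of H is never formed as a Hilbert space: the discriminant argument runs directly on
    the sum of the squares |u_i - t v_i|^2. *)
Lemma rdot_sum_CS (I : Type) (r : seq I) (u v : I -> H) :
  (\sum_(i <- r) rdot (u i) (v i)) ^+ 2 <=
  (\sum_(i <- r) rnorm (u i) ^+ 2) * (\sum_(i <- r) rnorm (v i) ^+ 2).
Proof.
apply: discriminant_le => [|t]; first by apply: sumr_ge0 => i _; exact: sqr_ge0.
have -> : \sum_(i <- r) rnorm (u i) ^+ 2 - 2 * t * (\sum_(i <- r) rdot (u i) (v i))
    + t ^+ 2 * (\sum_(i <- r) rnorm (v i) ^+ 2) =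
    \sum_(i <- r) rnorm (u i - t%:C%C *: v i) ^+ 2.
  rewrite !mulr_sumr -sumrB -big_split /=; apply: eq_bigr => i _.
  rewrite -!rdotvv rdotBl !rdotBr !rdotZl !rdotZr (rdotC (v i) (u i)); ring.
by apply: sumr_ge0 => i _; exact: sqr_ge0.
Qed.

Lemma rdot_CS u v : rdot u v <= rnorm u * rnorm v.
Proof.
apply: le_of_sqr; rewrite ?mulr_ge0 ?rnorm_ge0 // exprMn.
by have := rdot_sum_CS [:: tt] (fun=> u) (fun=> v); rewrite !big_seq1.
Qed.

Lemma rdot_gram (I : Type) (r : seq I) (x y : I -> A) u v :
  rdot (pi (gram r x y) u) v = \sum_(i <- r) rdot (pi (y i) u) (pi (x i) v).
Proof.
rewrite rep_sum rdot_suml; apply: eq_bigr => i _.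
by rewrite (repM hpi) rep_adj starK.
Qed.

(** Quadratic form of the positive element [gram r x x] at [h]. Inequalities between such forms
    replace the order of A. *)
Definition vsq (I : Type) (r : seq I) (x : I -> A) h : R :=
  \sum_(i <- r) rnorm (pi (x i) h) ^+ 2.

Lemma vsq_ge0 (I : Type) (r : seq I) (x : I -> A) h : 0 <= vsq r x h.
Proof. by apply: sumr_ge0 => i _; exact: sqr_ge0. Qed.

Lemma rdot_gram_vsq (I : Type) (r : seq I) (x : I -> A) h :
  rdot (pi (gram r x x) h) h = vsq r x h.
Proof. by rewrite rdot_gram; apply: eq_bigr => i _; rewrite rdotvv. Qed.

Lemma vsq_le_gram (I : Type) (r : seq I) (x : I -> A) h :
  vsq r x h <= rnorm (gram r x x) * rnorm h ^+ 2.
Proof.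
rewrite -rdot_gram_vsq (le_trans (rdot_CS _ _)) // expr2 mulrA.
by rewrite ler_wpM2r ?rnorm_ge0 ?rep_norm_le.
Qed.

(** Testing w = pi (gram r x y) h against itself gives |w|^2 = sum <y_i h, x_i w> <= (d |h|) (c
    |w|); then cancel |w|. *)
Lemma gram_le_sqrt (I : Type) (r : seq I) (x y : I -> A) (c d : R) :
  0 <= c -> 0 <= d ->
  (forall h, vsq r x h <= c ^+ 2 * rnorm h ^+ 2) ->
  (forall h, vsq r y h <= d ^+ 2 * rnorm h ^+ 2) ->
  rnorm (gram r x y) <= c * d.
Proof.
move=> c0 d0 hx hy; apply/rep_norm => [|h]; first exact: mulr_ge0.
set w := pi _ h.
have [->|w0] := eqVneq (rnorm w) 0; first by rewrite !mulr_ge0 ?rnorm_ge0.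
have wp : 0 < rnorm w by rewrite lt_def w0 rnorm_ge0.
rewrite -(ler_pM2r wp) -expr2 -rdotvv {1}/w rdot_gram.
apply: le_of_sqr; rewrite ?mulr_ge0 ?rnorm_ge0 //.
rewrite (le_trans (rdot_sum_CS _ _ _)) //.
rewrite (_ : (_ * _) ^+ 2 = (d ^+ 2 * rnorm h ^+ 2) * (c ^+ 2 * rnorm w ^+ 2)); last by ring.
by apply: ler_pM (vsq_ge0 _ _ _) (vsq_ge0 _ _ _) (hy h) (hx w).
Qed.

Lemma gram_le (I : Type) (r : seq I) (x : I -> A) (c : R) : 0 <= c ->
  (forall h, vsq r x h <= c * rnorm h ^+ 2) -> rnorm (gram r x x) <= c.
Proof.
move=> c0 hx; rewrite -(sqr_sqrtr c0) expr2.
by apply: gram_le_sqrt; rewrite ?sqrtr_ge0 ?sqr_sqrtr.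
Qed.

Lemma rep_gram_CS (I : Type) (r : seq I) (x y : I -> A) :
  rnorm (gram r x y) <=
    Num.sqrt (rnorm (gram r x x)) * Num.sqrt (rnorm (gram r y y)).
Proof.
by apply: gram_le_sqrt; rewrite ?sqrtr_ge0 ?sqr_sqrtr ?rnorm_ge0 // => h;
  exact: vsq_le_gram.
Qed.

(** [vsq] is a sum of nonnegative terms, hence grows with the list, and the norm of a Gram sum is
    controlled by its quadratic form. *)
Lemma rep_gram_mono (I : Type) (r1 r2 r3 : seq I) (x : I -> A) :
  rnorm (gram r2 x x) <= rnorm (gram (r1 ++ r2 ++ r3) x x).
Proof.
apply: gram_le => [|h]; first exact: rnorm_ge0.
rewrite (le_trans _ (vsq_le_gram _ _ _)) // /vsq !big_cat /=.
have := vsq_ge0 r1 x h; have := vsq_ge0 r3 x h; rewrite /vsq; lra.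
Qed.

End Representation.

(** * Square roots and positivity *)

Section SquareRoot.
Variables (R : realType) (A : cstarAlgType R).

(* Visser's iteration: the limit [y] solves [2 y = t + y ^+ 2], that is,
   [(1 - y) ^+ 2 = 1 - t]. *)
Fixpoint visser (t : A) (k : nat) : A :=
  if k is k'.+1 then (2^-1)%:C%C *: (t + visser t k' * visser t k') else 0.

(** The same iteration in R with t = 1. It increases and stays below 1, so it converges and serves
    as a majorant; this covers the boundary case |t| = 1, where no geometric bound is available. *)
Fixpoint scalar_visser (k : nat) : R :=
  if k is k'.+1 then 2^-1 * (1 + scalar_visser k' ^+ 2) else 0.

Lemma scalar_visser_bound k : 0 <= scalar_visser k <= 1.
Proof.
elim: k => [|k /andP[h0 h1]] /=; first by rewrite lexx ler01.
by apply/andP; split; nra.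
Qed.

Lemma scalar_visser_incr k : scalar_visser k <= scalar_visser k.+1.
Proof.
have := scalar_visser_bound k; rewrite /=; set s := scalar_visser k.
move=> _; have := sqr_ge0 (1 - s); rewrite expr2; lra.
Qed.

Lemma scalar_visser_cauchy e : 0 < e -> exists N, forall n m,
  (N <= n)%N -> (n <= m)%N -> scalar_visser m - scalar_visser n < e.
Proof.
move=> e0.
have : cvgn scalar_visser.
  apply: nondecreasing_is_cvgn; first exact/nondecreasing_seqP/scalar_visser_incr.
  by exists 1 => _ [n _ <-]; case/andP: (scalar_visser_bound n).
have e2 : 0 < e / 2 by rewrite divr_gt0.
move=> /cvgrPdist_lt/(_ _ e2)[N _ NP]; exists N => n m Nn nm.
have := NP n Nn; have := NP m (leq_trans Nn nm); rewrite /= !ltr_norml.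
by move=> /andP[? ?] /andP[? ?]; lra.
Qed.

(** The increments satisfy y'^2 - y^2 = y' (y' - y) + (y' - y) y, an identity that survives
    noncommutativity and that the scalar iteration satisfies too; so both bounds propagate
    together. *)
Lemma visser_step (t : A) k : rnorm t <= 1 ->
  rnorm (visser t k) <= scalar_visser k /\
  rnorm (visser t k.+1 - visser t k) <= scalar_visser k.+1 - scalar_visser k.
Proof.
move=> t1; have half x : rnorm ((2^-1)%:C%C *: x : A) = 2^-1 * rnorm x.
  by rewrite rnormZ ger0_norm.
elim: k => [|k [yk dk]].
  rewrite /= rnorm0 lexx mul0r addr0 expr0n /= addr0 mulr1 !subr0.
  by split=> //; rewrite half; lra.
have yk1 : rnorm (visser t k.+1) <= scalar_visser k.+1.
  rewrite -(subrK (visser t k) (visser t k.+1)) (le_trans (rnormD _ _)) //.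
  by move: dk yk => /=; lra.
split=> //.
set y' := visser t k.+1 in dk yk1 *; set s' := scalar_visser k.+1 in dk yk1 *.
set y := visser t k in dk yk *; set s := scalar_visser k in dk yk *.
have -> : visser t k.+2 - y' =
    (2^-1)%:C%C *: (y' * (y' - y) + (y' - y) * y).
  rewrite {2}/y' /= -/y -/y' -scalerBr opprD addrACA subrr add0r.
  by rewrite mulrBr mulrBl addrA subrK.
have -> : scalar_visser k.+2 - s' = 2^-1 * (s' * (s' - s) + (s' - s) * s).
  by rewrite -[scalar_visser _]/(2^-1 * (1 + s' ^+ 2)) [X in _ - X = _](_ : _ = 2^-1 * (1 + s ^+ 2)) //; ring.
rewrite half ler_pM2l // (le_trans (rnormD _ _)) //.
by apply: lerD; rewrite (le_trans (rnormM _ _)) // ler_pM ?rnorm_ge0.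
Qed.

Lemma visser_dist (t : A) n m : rnorm t <= 1 -> (n <= m)%N ->
  rnorm (visser t m - visser t n) <= scalar_visser m - scalar_visser n.
Proof.
move=> t1 /subnK <-; elim: (m - n)%N => [|k IH]; first by rewrite !subrr rnorm0.
rewrite addSn; set p := (k + n)%N in IH *.
rewrite (le_trans (rnorm_dist3 _ (visser t p) _)) //.
have := (visser_step p t1).2; lra.
Qed.

Lemma sqrt_one_minus (t : A) : rnorm t <= 1 -> star t = t ->
  exists2 b : A, star b = b & b * b = 1 - t.
Proof.
move=> t1 st.
have [|y yP] := @scauchy_slim _ _ (visser t).
  move=> e e0; have [N NP] := scalar_visser_cauchy e0.
  exists N => m n Nm Nn; have [nm|/ltnW mn] := leqP n m.
    by rewrite (le_lt_trans (visser_dist _ _)) // NP.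
  by rewrite rnorm_distC (le_lt_trans (visser_dist _ _)) // NP.
have sy : star y = y.
  apply: (slim_unique (s := visser t)) (yP) => //.
  have svis k : star (visser t k) = visser t k.
    elim: k => [|k IH]; first exact: star0.
    by rewrite /= starZr starD starM st IH.
  under [visser t]funext => k do rewrite -svis.
  apply: (@slim_image _ _ _ _ 1) yP => u v.
  by rewrite -starN -starD rnorm_star mul1r.
have y1 k : rnorm (visser t k) <= 1.
  by rewrite (le_trans (visser_step k t1).1) //; case/andP: (scalar_visser_bound k).
have yy : (2^-1)%:C%C *: (t + y * y) = y.
  apply: (slim_unique (s := fun k => visser t k.+1)); last first.
    by move=> e /yP[N NP]; exists N => n Nn; apply: NP; rewrite ltnW.
  move=> e e0; have c0 : 0 < 1 + rnorm y by rewrite ltr_wpDr ?rnorm_ge0.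
  have [|N NP] := yP (e / (1 + rnorm y)); first exact: divr_gt0.
  exists N => n /NP; rewrite ltr_pdivlMr // => en.
  rewrite /= -scalerBr rnormZ opprD addrACA subrr add0r ger0_norm //.
  set z := visser t n in en *.
  have -> : z * z - y * y = z * (z - y) + (z - y) * y.
    by rewrite mulrBr mulrBl addrA subrK.
  have := rnormD (z * (z - y)) ((z - y) * y).
  have := rnormM z (z - y); have := rnormM (z - y) y.
  have := y1 n; rewrite -/z; have := rnorm_ge0 (z - y); have := rnorm_ge0 y; have := rnorm_ge0 z.
  move: en; set p := rnorm (z - y); set q := rnorm z; set r := rnorm y.
  move=> *; nra.
exists (1 - y); first by rewrite starD starN star1 sy.
have {}yy : t + y * y = y + y.
  rewrite -[in RHS]yy -scalerDl -rmorphD.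
  by rewrite (_ : 2^-1 + 2^-1 = 1) ?rmorph1 ?scale1r //; field.
have -> : t = y + y - y * y by rewrite -yy addrK.
rewrite mulrBl mul1r mulrBr mulr1 !opprB -!addrA.
by rewrite opprD (addrCA (y * y)).
Qed.

End SquareRoot.

(** Write a = s (1 - t) with s > |a|. The form of t lies between 0 and that of the identity, hence
    |t| <= 1, and a root of 1 - t exists inside A. *)
Lemma cstar_nneg_rep (R : realType) (A : cstarAlgType R)
    (H : completeNormedModType R[i]) (dot : {dot H for Num.conj})
    (pi : A -> {linear H -> H}) (a : A) :
  hilbert_dot dot -> isometric_star_rep dot pi -> star a = a ->
  (forall h, 0 <= rdot dot (pi a h) h) -> cstar_nneg a.
Proof.
move=> hd hp sa a0; pose s := rnorm a + 1.
have s0 : 0 < s by rewrite ltr_wpDl ?rnorm_ge0.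
pose t := 1 - (s^-1)%:C%C *: a.
have pt h : pi t h = h - (s^-1)%:C%C *: pi a h.
  by rewrite (repB hp) (rep1 hp) (repZ hp).
have st : star t = t by rewrite starD starN starZr sa star1.
have Qb h : 0 <= rdot dot (pi t h) h <= rnorm h ^+ 2.
  rewrite pt rdotBl rdotZl (rdotvv hd) lerBlDr lerDl subr_ge0.
  rewrite mulr_ge0 ?invr_ge0 ?(ltW s0) // andbT mulrC ler_pdivrMr //.
  have := rdot_CS hd (pi a h) h.
  have := ler_wpM2r (rnorm_ge0 h) (rep_norm_le hp a h).
  by have := sqr_ge0 (rnorm h); rewrite /s; lra.
have [|//|b sb bb] := @sqrt_one_minus _ A t.
  apply/(rep_norm hp) => // h; rewrite mul1r.
  set k := pi t h.
  (* Cauchy-Schwarz for the semidefinite form <t u, v>. With k = t h it reads |k|^4 <= <t h, h> <t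
     k, k> <= |h|^2 |k|^2. *)
  have CS : rdot dot (pi t h) k ^+ 2 <= rdot dot (pi t h) h * rdot dot (pi t k) k.
    apply: discriminant_le => [|r]; first by case/andP: (Qb k).
    have /andP[+ _] := Qb (h - r%:C%C *: k).
    rewrite linearB linearZ /= -/k rdotBl !rdotBr !rdotZl !rdotZr.
    rewrite (rep_adj hp t k h) st -/k; lra.
  have /andP[h0 h1] := Qb h; have /andP[k0 k1] := Qb k.
  move: CS; rewrite -/k (rdotvv hd).
  have [->|kn] := eqVneq (rnorm k) 0; first by rewrite rnorm_ge0.
  have kp : 0 < rnorm k by rewrite lt_def kn rnorm_ge0.
  move=> CS; apply: le_of_sqr; rewrite ?rnorm_ge0 //.
  rewrite -(ler_pM2r (exprn_gt0 2 kp)) -expr2 (le_trans CS) //.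
  exact: ler_pM.
exists ((Num.sqrt s)%:C%C *: b).
rewrite starZr sb scaler_mull scaler_mulr bb scalerA -rmorphM -expr2.
rewrite sqr_sqrtr ?ltW // /t subKr scalerA -rmorphM divff ?gt_eqF //.
by rewrite rmorph1 scale1r.
Qed.

(** * Projection onto the common kernel of functionals on H^n *)

Lemma slim_fin (R : realType) (V : normedModType R[i]) (I : finType)
    (s : I -> nat -> V) (v : I -> V) (e : R) :
  (forall i, slim (s i) (v i)) -> 0 < e ->
  exists N, forall n, (N <= n)%N -> forall i, rnorm (s i n - v i) < e.
Proof.
move=> sv e0; have /choice[N NP] i := sv i e e0.
exists (\max_i N i)%N => n Nn i; apply: NP.
by rewrite (leq_trans _ Nn) // (leq_bigmax i).
Qed.

Lemma slim_sum (R : realType) (V : normedModType R[i]) (I : Type) (r : seq I)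
    (s : I -> nat -> V) (v : I -> V) :
  (forall i, slim (s i) (v i)) ->
  slim (fun n => \sum_(i <- r) s i n) (\sum_(i <- r) v i).
Proof.
move=> sv; elim: r => [|i r IH].
  by under eq_fun do rewrite big_nil; rewrite big_nil; exact: slim_cst.
by under eq_fun do rewrite big_cons; rewrite big_cons; exact: slimD.
Qed.

Section Annihilator.
Variables (R : realType) (A : cstarAlgType R).
Variables (H : completeNormedModType R[i]) (dot : {dot H for Num.conj}).
Variable pi : A -> {linear H -> H}.
Hypotheses (hdot : hilbert_dot dot) (hpi : isometric_star_rep dot pi).
Variables (n : nat) (J : set ('I_n -> A)).
Implicit Types (eta zeta : 'I_n -> H) (b : 'I_n -> 'I_n -> A).
Local Notation rdot := (rdot dot).

Lemma rdotZJ (c : R[i]) u v : rdot (c *: u) v = rdot u (c^* *: v).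
Proof. by rewrite /rdot linearZl_LR linearZr_LR /= conjCK. Qed.

(** Cauchy-Schwarz for the real form, applied to u and to i u, bounds the real and the imaginary
    part separately; the factor 2 is crude but harmless. *)
Lemma dot_norm_le u v : `|dot u v| <= (2 * (rnorm u * rnorm v))%:C%C.
Proof.
have sq w : rdot w v ^+ 2 <= (rnorm w * rnorm v) ^+ 2.
  by have := rdot_sum_CS hdot [:: tt] (fun=> w) (fun=> v); rewrite !big_seq1 exprMn.
have h1 := sq u; have := sq ('i%C *: u).
have -> : rnorm ('i%C *: u) = rnorm u.
  by rewrite /rnorm normrZ normc_def /= expr0n add0r expr1n sqrtr1 mul1r.
have -> : rdot ('i%C *: u) v = - complex.Im (dot u v).
  rewrite /rdot linearZl_LR /=.
  by case: (dot u v) => x y /=; rewrite mul0r mul1r sub0r.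
rewrite sqrrN => h2; rewrite normc_def lecR.
have m0 : 0 <= rnorm u * rnorm v by rewrite mulr_ge0 ?rnorm_ge0.
apply: le_of_sqr; first by rewrite mulr_ge0.
rewrite sqr_sqrtr ?addr_ge0 ?sqr_ge0 //.
move: h1 h2; rewrite /rdot; nra.
Qed.

Definition vdot eta zeta : R := \sum_i rdot (eta i) (zeta i).
Definition vnsq eta : R := \sum_i rnorm (eta i) ^+ 2.
(** Adjoint of the column operator h |-> (x_i h)_i from H to H^n. *)
Definition adj (x : 'I_n -> A) eta : H := \sum_i pi (star (x i)) (eta i).
Definition mact b eta : 'I_n -> H := fun i => \sum_j pi (b i j) (eta j).

Definition common_ker eta := forall x, J x -> adj x eta = 0.

(* The orthogonal projection onto the common kernel is the limit of matrices
   that agree with it when tested against the common kernel. *)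
Definition ker_test b := forall eta zeta, common_ker zeta ->
  vdot (mact b eta) zeta = vdot eta zeta.

Lemma vdotvv eta : vdot eta eta = vnsq eta.
Proof. by apply: eq_bigr => i _; rewrite rdotvv. Qed.

Lemma vnsq_ge0 eta : 0 <= vnsq eta.
Proof. by apply: sumr_ge0 => i _; exact: sqr_ge0. Qed.

Lemma le_vnsq eta i : rnorm (eta i) ^+ 2 <= vnsq eta.
Proof.
by rewrite /vnsq (bigD1 i) //= lerDl sumr_ge0 // => j _; exact: sqr_ge0.
Qed.

Lemma adj_sub x eta zeta : adj x (fun i => eta i - zeta i) = adj x eta - adj x zeta.
Proof. by rewrite -sumrB; apply: eq_bigr => i _; rewrite linearB. Qed.

Lemma rdot_adj x h zeta :
  \sum_i rdot (pi (x i) h) (zeta i) = rdot h (adj x zeta).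
Proof.
rewrite rdotC rdot_suml; apply: eq_bigr => i _.
by rewrite (rep_adj hpi) rdotC.
Qed.

Lemma ker_test1 : ker_test (fun i j => if i == j then 1 else 0).
Proof.
move=> eta zeta _; apply: eq_bigr => i _; congr (rdot _ _).
rewrite /mact (bigD1 i) //= eqxx (rep1 hpi) big1 ?addr0 // => j ji.
by rewrite eq_sym (negbTE ji) (rep0 hpi).
Qed.

(** The matrix (1 - t x x^* ) b: a gradient step for |x^* b eta|^2 that leaves pairings with the
    common kernel unchanged when [J x] holds. *)
Definition perturb (t : R) (x : 'I_n -> A) b i j : A :=
  b i j - t%:C%C *: (x i * \sum_l star (x l) * b l j).

Lemma mact_perturb t x b eta i : mact (perturb t x b) eta i =
  mact b eta i - t%:C%C *: pi (x i) (adj x (mact b eta)).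
Proof.
rewrite /mact /adj linear_sum scaler_sumr.
under [X in _ - X]eq_bigr do rewrite /= linear_sum linear_sum scaler_sumr.
rewrite exchange_big /= -sumrB; apply: eq_bigr => j _.
rewrite (repB hpi) (repZ hpi) (repM hpi) (rep_sum hpi) linear_sum scaler_sumr.
by congr (_ - _); apply: eq_bigr => l _; rewrite (repM hpi).
Qed.

Lemma ker_test_perturb t x b : J x -> ker_test b -> ker_test (perturb t x b).
Proof.
move=> Jx hb eta zeta hz; rewrite -(hb eta zeta hz) /vdot.
under eq_bigr do rewrite mact_perturb rdotBl rdotZl.
rewrite sumrB -mulr_sumr rdot_adj hz // [rdot _ 0]rdotC rdot0l.
by rewrite mulr0 subr0.
Qed.

Definition midpoint b b' : 'I_n -> 'I_n -> A :=
  fun i j => (2^-1)%:C%C *: (b i j + b' i j).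

Lemma mact_midpoint b b' eta i :
  mact (midpoint b b') eta i = (2^-1)%:C%C *: (mact b eta i + mact b' eta i).
Proof.
rewrite /mact -big_split scaler_sumr; apply: eq_bigr => j _.
by rewrite /= (repZ hpi) (repD hpi).
Qed.

Lemma ker_test_midpoint b b' : ker_test b -> ker_test b' -> ker_test (midpoint b b').
Proof.
move=> hb hb' eta zeta hz; rewrite /vdot.
under eq_bigr do rewrite mact_midpoint rdotZl rdotDl.
rewrite -mulr_sumr big_split /= -!/(vdot _ _) hb // hb' //; lra.
Qed.

Lemma parallelogram (u v : H) : rnorm (u - v) ^+ 2 =
  2 * rnorm u ^+ 2 + 2 * rnorm v ^+ 2 - 4 * rnorm ((2^-1)%:C%C *: (u + v)) ^+ 2.
Proof.
rewrite rnormZ ger0_norm // exprMn -!(rdotvv hdot).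
rewrite !rdotDl !rdotDr !rdotNl (rdotC _ u (- v)) (rdotC _ v (- v)) !rdotNl.
by rewrite (rdotC _ v u); field.
Qed.

(** Every admissible b has the same component as the identity along the common kernel, so minimizing
    the total size of the vectors b eta_k pushes them onto that component. Convexity makes a
    minimizing sequence Cauchy, and gradient steps show that the limits lie in the kernel. Finitely
    many vectors are treated with one sequence of matrices, as weak closedness will require. *)
Lemma ker_limit r (eta : 'I_r -> 'I_n -> H) :
  exists (b : nat -> 'I_n -> 'I_n -> A) (z : 'I_r -> 'I_n -> H),
  [/\ forall m, ker_test (b m),
      forall k i, slim (fun m => mact (b m) (eta k) i) (z k i)
    & forall k, common_ker (z k)].
Proof.
pose Phi b := \sum_k vnsq (mact b (eta k)).
pose S := Phi @` ker_test.
have Phi0 b : 0 <= Phi b by apply: sumr_ge0 => k _; exact: vnsq_ge0.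
have hS : has_inf S.
  split; first by exists (Phi (fun i j => if i == j then 1 else 0));
    exists (fun i j => if i == j then 1 else 0) => //; exact: ker_test1.
  by exists 0 => _ [b _ <-].
have dle b : ker_test b -> inf S <= Phi b by move=> hb; apply: ge_inf; [exact: hS.2 | exists b].
have /choice[b bP] : forall m : nat, exists b, ker_test b /\ Phi b < inf S + m.+1%:R^-1.
  move=> m; have [|_ [b hb <-] hlt] := @inf_adherent _ S m.+1%:R^-1 _ hS; first by rewrite invr_gt0.
  by exists b.
have hB m := (bP m).1; have hlt m := (bP m).2.
(* Parallelogram identity: the midpoint is admissible, so its value is at least the infimum, while
   both ends exceed it by less than 1/(m+1) and 1/(m'+1). *)
have dist m m' k i : rnorm (mact (b m) (eta k) i - mact (b m') (eta k) i) ^+ 2 <=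
    2 * m.+1%:R^-1 + 2 * m'.+1%:R^-1.
  have : \sum_k \sum_i rnorm (mact (b m) (eta k) i - mact (b m') (eta k) i) ^+ 2 =
      2 * Phi (b m) + 2 * Phi (b m') - 4 * Phi (midpoint (b m) (b m')).
    rewrite /Phi !mulr_sumr -big_split -sumrB; apply: eq_bigr => l _.
    rewrite /vnsq !mulr_sumr -big_split -sumrB; apply: eq_bigr => j _.
    by rewrite /= mact_midpoint parallelogram.
  have := dle _ (ker_test_midpoint (hB m) (hB m')).
  have := hlt m; have := hlt m' => h1 h2 h3 h4.
  apply: (@le_trans _ _ (\sum_k \sum_i rnorm (mact (b m) (eta k) i - mact (b m') (eta k) i) ^+ 2)).
    rewrite (bigD1 k) //= (bigD1 i) //= -addrA lerDl addr_ge0 ?sumr_ge0 // => [j|l] _.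
      exact: sqr_ge0.
    by apply: sumr_ge0 => j _; exact: sqr_ge0.
  rewrite h4; move: h1 h2 h3.
  by move: (m.+1%:R^-1 : R) (m'.+1%:R^-1 : R) (Phi _) (Phi _) (Phi _) => *; lra.
have small (e : R) : 0 < e -> exists N, forall m, (N <= m)%N -> m.+1%:R^-1 < e.
  move=> e0; have := @near_infty_natSinv_lt R (PosNum e0).
  by move=> [N _ NP]; exists N.
have /choice[z0 z0P] (ki : 'I_r * 'I_n) :
    exists z, slim (fun m => mact (b m) (eta ki.1) ki.2) z.
  apply: scauchy_slim => e e0.
  have [|N NP] := small (e ^+ 2 / 4); first by rewrite divr_gt0 ?exprn_gt0.
  exists N => m m' Nm Nm'; have := dist m m' ki.1 ki.2.
  have := NP _ Nm; have := NP _ Nm'; set w := rnorm _ => h1 h2 h3.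
  apply: lt_of_sqr; rewrite ?(ltW e0) //; move: h1 h2 h3.
  by move: (m.+1%:R^-1 : R) (m'.+1%:R^-1 : R) => *; lra.
have zP k i := z0P (k, i).
exists b, (fun k i => z0 (k, i)); split=> // k x Jx.
pose s := \sum_i rnorm (x i) ^+ 2 + 1.
have s0 : 0 < s by rewrite ltr_wpDl // sumr_ge0 // => i _; exact: sqr_ge0.
have wsmall m : rnorm (adj x (mact (b m) (eta k))) ^+ 2 <= s * m.+1%:R^-1.
  have := dle _ (ker_test_perturb s^-1 Jx (hB m)).
  pose w l := adj x (mact (b m) (eta l)).
  pose W := \sum_l rnorm (w l) ^+ 2.
  (* Since |x w|^2 <= s |w|^2, a step of length 1/s lowers [Phi] by at least W/s. As [b m] is within
     1/(m+1) of the infimum, this forces W <= s/(m+1). *)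
  have : Phi (perturb s^-1 x (b m)) <= Phi (b m) - s^-1 * W.
    rewrite /Phi /W mulr_sumr -sumrB; apply: ler_sum => l _.
    rewrite /vnsq; under eq_bigr do rewrite mact_perturb -(rdotvv hdot) rdotBl
      !rdotBr !rdotZl !rdotZr (rdotC dot _ (mact _ _ _)) !(rdotvv hdot).
    set y := mact (b m) (eta l).
    rewrite (eq_bigr (fun i => rnorm (y i) ^+ 2 - 2 * s^-1 * rdot (pi (x i) (w l)) (y i) +
      s^-1 ^+ 2 * rnorm (pi (x i) (w l)) ^+ 2)); last first.
      by move=> i _; rewrite (rdotC dot (y i)) -/(w l); ring.
    rewrite big_split sumrB -!mulr_sumr /= rdot_adj -/(w l) (rdotvv hdot).
    have : \sum_i rnorm (pi (x i) (w l)) ^+ 2 <= s * rnorm (w l) ^+ 2.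
      rewrite /s mulrDl mul1r mulr_suml ler_wpDr ?sqr_ge0 //.
      apply: ler_sum => i _; rewrite -exprMn ler_sqr ?nnegrE ?mulr_ge0 ?rnorm_ge0 //.
      exact: (rep_norm_le hpi).
    move/(ler_wpM2l (sqr_ge0 s^-1)).
    have -> : s^-1 ^+ 2 * (s * rnorm (w l) ^+ 2) = s^-1 * rnorm (w l) ^+ 2.
      by field; rewrite gt_eqF.
    have aux (p q t : R) : p <= q -> t - 2 * q + p <= t - q by move=> *; lra.
    by rewrite -(mulrA 2); exact: aux.
  have := hlt m => h1 h2 h3.
  have aux (p q t u v : R) : p < t + v -> q <= p - u -> t <= q -> u <= v.
    by move=> *; lra.
  have := aux _ _ _ _ _ h1 h2 h3.
  rewrite -(ler_pM2l s0) mulrA divff ?gt_eqF // mul1r; apply: le_trans.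
  by rewrite /W (bigD1 k) //= lerDl sumr_ge0 // => l _; exact: sqr_ge0.
apply: (slim_unique (s := fun m => adj x (mact (b m) (eta k)))).
  apply: slim_sum => i.
  apply: (slim_image (c := rnorm (star (x i)))) (zP k i) => u v.
  by rewrite -linearB (rep_norm_le hpi).
move=> e e0; have [|N NP] := small (e ^+ 2 / s); first by rewrite divr_gt0 ?exprn_gt0.
exists N => m /NP; rewrite ltr_pdivlMr // => lt1; have := wsmall m.
rewrite subr0; set w := rnorm _ => le1.
by apply: lt_of_sqr; rewrite ?(ltW e0) // (le_lt_trans le1) // mulrC.
Qed.

End Annihilator.

Section KernelProjection.
Variables (R : realType) (A : cstarAlgType R).
Variables (H : completeNormedModType R[i]) (dot : {dot H for Num.conj}).
Variable pi : A -> {linear H -> H}.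
Hypotheses (hdot : hilbert_dot dot) (hpi : isometric_star_rep dot pi).
Variables (n : nat) (J : set ('I_n -> A)).
Implicit Types (eta zeta : 'I_n -> H) (b : 'I_n -> 'I_n -> A).
Local Notation rdot := (rdot dot).
Local Notation vdot := (vdot dot).
Local Notation common_ker := (common_ker pi J).

Definition is_ker_proj eta zeta : Prop :=
  common_ker zeta /\ forall z, common_ker z -> vdot zeta z = vdot eta z.

Lemma ker_test_slim (s : nat -> 'I_n -> 'I_n -> A) eta z :
  (forall m, ker_test dot pi J (s m)) ->
  (forall i, slim (fun m => mact pi (s m) eta i) (z i)) ->
  forall zeta, common_ker zeta -> vdot z zeta = vdot eta zeta.
Proof.
move=> hs hz zeta kz; apply/eqP; rewrite -subr_eq0 -normr_eq0; apply/eqP.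
apply/le_anti; rewrite normr_ge0 andbT; apply/ler_addgt0Pr => e e0; rewrite add0r.
pose c := \sum_i rnorm (zeta i) + 1.
have c0 : 0 < c by rewrite ltr_wpDl // sumr_ge0 // => i _; exact: rnorm_ge0.
have [N NP] := slim_fin hz (divr_gt0 e0 c0).
rewrite -(hs N eta zeta kz) /vdot -sumrB (le_trans (ler_norm_sum _ _ _)) //.
rewrite (@le_trans _ _ (\sum_i e / c * rnorm (zeta i))) //.
  apply: ler_sum => i _; rewrite -rdotBl.
  have d w : rnorm w = rnorm (mact pi (s N) eta i - z i) ->
      rdot w (zeta i) <= e / c * rnorm (zeta i).
    move=> dw; rewrite (le_trans (rdot_CS hdot _ _)) // ler_wpM2r ?rnorm_ge0 //.
    by rewrite dw ltW // NP.
  by rewrite ler_norml lerNl -rdotNl !d // ?rnormN rnorm_distC.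
rewrite -mulr_sumr -mulrA ger_pMr // mulrC ler_pdivrMr // mul1r /c.
by rewrite lerDl.
Qed.

Lemma ker_proj_ex eta : exists zeta, is_ker_proj eta zeta.
Proof.
have [b [z [hb hz kz]]] := ker_limit hdot hpi J (fun _ : 'I_1 => eta).
by exists (z ord0); split=> //; exact: ker_test_slim hb (hz ord0).
Qed.

Definition ker_proj eta : 'I_n -> H := projT1 (cid (ker_proj_ex eta)).

Lemma ker_projP eta : is_ker_proj eta (ker_proj eta).
Proof. by rewrite /ker_proj; case: cid. Qed.

(** Two candidates differ by a vector of the common kernel that is orthogonal to that kernel, hence
    to itself. *)
Lemma ker_proj_unique eta zeta : is_ker_proj eta zeta -> ker_proj eta = zeta.
Proof.
move=> [kz hz]; have [kp hp] := ker_projP eta.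
pose d i := ker_proj eta i - zeta i.
have kd : common_ker d by move=> x Jx; rewrite adj_sub kp ?kz ?subrr.
have d0 : vnsq d = 0.
  rewrite -(vdotvv hdot) /vdot; under eq_bigr do rewrite {1}/d rdotBl.
  by rewrite sumrB -!/(vdot _ _) hp // hz // subrr.
apply/funext => i; apply/eqP; rewrite -subr_eq0; apply/eqP/rnorm0_eq0.
apply/eqP; rewrite -sqrf_eq0; apply/eqP/le_anti.
by rewrite sqr_ge0 andbT; have := le_vnsq d i; rewrite d0.
Qed.

Lemma common_ker_lin (c : R[i]) eta zeta : common_ker eta -> common_ker zeta ->
  common_ker (fun i => c *: eta i + zeta i).
Proof.
move=> ke kz x Jx; rewrite /adj.
under eq_bigr do rewrite linearP.
by rewrite big_split -scaler_sumr /= -!/(adj _ _ _) ke // kz // scaler0 addr0.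
Qed.

(** Complex homogeneity is obtained from the real form by moving the scalar, conjugated, to the test
    vector; the common kernel is a complex subspace. *)
Lemma ker_proj_lin (c : R[i]) eta zeta i :
  ker_proj (fun i => c *: eta i + zeta i) i = c *: ker_proj eta i + ker_proj zeta i.
Proof.
have [ke he] := ker_projP eta; have [kz hz] := ker_projP zeta.
rewrite (@ker_proj_unique _ (fun i => c *: ker_proj eta i + ker_proj zeta i)) //.
split; first exact: common_ker_lin.
have lin f g z : vdot (fun i => c *: f i + g i) z = vdot f (fun i => c^* *: z i) + vdot g z.
  by rewrite -big_split; apply: eq_bigr => j _; rewrite rdotDl rdotZJ.
move=> z kz'; rewrite !lin hz // he // => x Jx.
have k0 : common_ker (fun=> 0).
  by move=> y _; rewrite /adj big1 // => j _; rewrite linear0.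
by have := common_ker_lin c^* kz' k0 Jx; under [X in adj _ _ X]eq_fun do rewrite addr0.
Qed.

Lemma ker_proj_norm eta : vnsq (ker_proj eta) <= vnsq eta.
Proof.
have [ke he] := ker_projP eta; set z := ker_proj eta in ke he *.
have := rdot_sum_CS hdot (index_enum _) eta z.
rewrite -/(vdot eta z) -he // -!/(vnsq _) (vdotvv hdot).
have [->|z0] := eqVneq (vnsq z) 0; first by rewrite vnsq_ge0.
by rewrite expr2 ler_pM2r // lt_def z0 vnsq_ge0.
Qed.

Lemma ker_proj_approx r (eta : 'I_r -> 'I_n -> H) (e : R) : 0 < e ->
  exists b, forall k i, rnorm (ker_proj (eta k) i - mact pi b (eta k) i) < e.
Proof.
move=> e0; have [b [z [hb hz kz]]] := ker_limit hdot hpi J eta.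
have [|N NP] := @slim_fin _ _ _ (fun ki m => mact pi (b m) (eta ki.1) ki.2)
  (fun ki => z ki.1 ki.2) e _ e0; first by move=> [k i]; exact: hz.
exists (b N) => k i.
rewrite (@ker_proj_unique _ (z k)).
  by rewrite rnorm_distC; exact: (NP N _ (k, i)).
by split=> //; exact: ker_test_slim hb (hz k).
Qed.

Definition unit_vec (j : 'I_n) (h : H) : 'I_n -> H := fun l => if l == j then h else 0.

Lemma vnsq_unit_vec j h : vnsq (unit_vec j h) = rnorm h ^+ 2.
Proof.
rewrite /vnsq (bigD1 j) //= /unit_vec eqxx big1 ?addr0 // => i /negbTE->.
by rewrite rnorm0 expr0n.
Qed.

Lemma mact_unit_vec b j h i : mact pi b (unit_vec j h) i = pi (b i j) h.
Proof.
rewrite /mact (bigD1 j) //= /unit_vec eqxx big1 ?addr0 // => l /negbTE->.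
by rewrite linear0.
Qed.

(** The (i, j) entry of the projection is a bounded operator on H, and on finitely many vectors it
    is approximated by the (i, j) entries of matrices over A. *)
Lemma ker_proj_entry (i j : 'I_n) : weakly_closed_range dot pi ->
  exists a : A, forall h, ker_proj (unit_vec j h) i = pi a h.
Proof.
move=> hw; pose T h := ker_proj (unit_vec j h) i.
have linT : linear T.
  move=> c u v; rewrite /T -ker_proj_lin; congr (ker_proj _ i).
  apply/funext => l; rewrite /unit_vec; case: eqP => // _.
  by rewrite scaler0 addr0.
have TN h : rnorm (T h) <= rnorm h.
  apply: le_of_sqr; rewrite ?rnorm_ge0 // -(vnsq_unit_vec j h).
  exact: le_trans (le_vnsq (ker_proj (unit_vec j h)) i) (ker_proj_norm _).
pose L : {linear H -> H} := HB.pack T (GRing.isLinear.Build _ _ _ _ T linT).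
have cL : continuous L.
  move=> x; apply/cvgrPdist_lt => e e0.
  have : \forall z \near x, `|x - z| < e by move: e e0; apply/cvgrPdist_lt; exact: cvg_id.
  apply: filterS => z; apply: le_lt_trans.
  by rewrite -linearB !rnormE lecR; exact: TN.
have [|a aP] := hw L cL; last by exists a.
move=> m x y e e0.
have /complex_realP[e' ee'] : e \is Num.real by rewrite ger0_real // ltW.
have e'0 : 0 < e' by rewrite -ltcR -ee'.
pose c := \sum_k rnorm (y k) + 1.
have c0 : 0 < c by rewrite ltr_wpDl // sumr_ge0 // => k _; exact: rnorm_ge0.
(* The constant [c] dominates every |y_k|, and the 2 compensates the factor in [dot_norm_le]. *)
have [|b bP] := @ker_proj_approx m (fun k => unit_vec j (x k)) (e' / (2 * c)).
  by rewrite divr_gt0 // mulr_gt0.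
exists (b i j) => k; rewrite (le_lt_trans (dot_norm_le hdot _ _)) // ee' ltcR.
have := bP k i; rewrite mact_unit_vec -[ker_proj _ i]/(L (x k)).
set w := rnorm _ => ew.
have yc : rnorm (y k) < c.
  rewrite /c (bigD1 k) //= -addrA ltrDl ltr_wpDl // sumr_ge0 // => l _.
  exact: rnorm_ge0.
rewrite (@le_lt_trans _ _ (2 * (w * c))) //.
  by rewrite ler_pM2l // ler_wpM2l ?rnorm_ge0 // ltW.
by move: ew; rewrite ltr_pdivlMr ?mulr_gt0 // mulrCA.
Qed.

End KernelProjection.

(** P is the projection onto the common kernel. Its columns map H into the kernel, hence annihilate
    J; conversely, if y annihilates J then (y_l h)_l lies in the kernel for every h and is fixed by
    P. Faithfulness carries both identities back to A. *)
Lemma annihilator_generated (R : realType) (A : cstarAlgType R) (n : nat)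
    (J : set ('I_n -> A)) : wstar_algebra A ->
  exists P : 'I_n -> 'I_n -> A,
    (forall x j, J x -> \sum_i star (x i) * P i j = 0) /\
    (forall y, (forall x, J x -> \sum_i star (x i) * y i = 0) ->
       forall i, y i = \sum_j P i j * y j).
Proof.
move=> [H [dot [pi [hdot hpi hw]]]].
have /choice[P0 P0P] : forall ij : 'I_n * 'I_n, exists a : A,
    forall h, ker_proj hdot hpi J (unit_vec ij.2 h) ij.1 = pi a h.
  by move=> ij; exact: ker_proj_entry.
exists (fun i j => P0 (i, j)); split=> [x j Jx|y hy i].
  apply: (rep_faithful hpi) => h.
  rewrite (rep_sum hpi).
  under eq_bigr do rewrite (repM hpi) -P0P /=.
  exact: (ker_projP hdot hpi J (unit_vec j h)).1.
apply: (rep_inj hpi) => h.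
rewrite (rep_sum hpi); under eq_bigr do rewrite (repM hpi) -P0P /=.
pose eta l := pi (y l) h.
have keta : common_ker pi J eta.
  move=> x Jx; rewrite /adj /eta -[RHS](rep0 hpi h) -(hy x Jx) (rep_sum hpi).
  by apply: eq_bigr => l _; rewrite (repM hpi).
(* The projection of eta is computed twice: as eta itself, and as the sum of the projections of its
   components. *)
rewrite -[LHS]/(eta i) -(@ker_proj_unique _ _ _ _ _ hdot hpi _ J eta eta) //.
rewrite (@ker_proj_unique _ _ _ _ _ hdot hpi _ J eta
  (fun l => \sum_j ker_proj hdot hpi J (unit_vec j (eta j)) l)) //.
split=> [x Jx|z kz].
  rewrite /adj; under eq_bigr do rewrite linear_sum.
  rewrite exchange_big big1 //= => j _.
  exact: (ker_projP hdot hpi J (unit_vec j (eta j))).1.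
rewrite /vdot; under eq_bigr do rewrite rdot_suml.
rewrite exchange_big; apply: eq_bigr => j _ /=.
rewrite -/(vdot dot _ z) (ker_projP hdot hpi J (unit_vec j (eta j))).2 //.
rewrite /vdot (bigD1 j) //= /unit_vec eqxx big1 ?addr0 // => l /negbTE->.
by rewrite rdot0l.
Qed.

(** * Real constants and Gram estimates stated without a representation *)

Lemma slim_ge (R : realType) (V : normedModType R[i]) (s : nat -> V) v (c : R) :
  slim s v -> (exists N, forall n, (N <= n)%N -> c <= rnorm (s n)) -> c <= rnorm v.
Proof.
move=> sv [N NP]; apply/ler_addgt0Pr => e e0; have [N' N'P] := sv e e0.
have := NP _ (leq_maxl N N'); have := N'P _ (leq_maxr N N').
have := rnormD (s (maxn N N') - v) v; rewrite subrK => *; lra.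
Qed.

Lemma sqrtC_real (R : realType) (r : R) : 0 <= r -> sqrtC r%:C%C = (Num.sqrt r)%:C%C.
Proof.
move=> r0; rewrite -{1}(sqr_sqrtr r0) rmorphXn /= sqrCK // ler0c.
exact: sqrtr_ge0.
Qed.

(** The constant in [bounded_Alinear] is an arbitrary complex number. Where p <= c q holds, c q is a
    nonnegative real, so it equals |c| q. *)
Lemma real_bound (R : realType) (X : Type) (D : set X) (p q : X -> R) (c : R[i]) :
  (forall x, D x -> 0 <= p x) -> (forall x, 0 <= q x) ->
  (forall x, D x -> (p x)%:C%C <= c * (q x)%:C%C) ->
  exists2 c' : R, 0 <= c' & forall x, D x -> p x <= c' * q x.
Proof.
move=> p0 q0 pq; exists (complex.Re `|c|) => [|x Dx].
  by rewrite -ler0c RRe_real ?normr_real.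
have cE : (complex.Re `|c|)%:C%C = `|c| by rewrite RRe_real ?normr_real.
have -> : (p x <= complex.Re `|c| * q x) = ((p x)%:C%C <= `|c| * (q x)%:C%C).
  by rewrite -[X in X * (q x)%:C%C]cE -rmorphM lecR.
rewrite -[(q x)%:C%C]ger0_norm ?ler0c //.
rewrite -normrM ger0_norm ?pq // (le_trans _ (pq x Dx)) // ler0c.
exact: p0.
Qed.

Section GramEstimates.
Variables (R : realType) (A : cstarAlgType R).
Hypothesis hA : wstar_algebra A.

Lemma gram_CS (I : Type) (r : seq I) (x y : I -> A) :
  rnorm (gram r x y) <=
    Num.sqrt (rnorm (gram r x x)) * Num.sqrt (rnorm (gram r y y)).
Proof. by have [H [dot [pi [hd hp _]]]] := hA; exact: (rep_gram_CS hd hp). Qed.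

Lemma gram_mono (I : Type) (r1 r2 r3 : seq I) (x : I -> A) :
  rnorm (gram r2 x x) <= rnorm (gram (r1 ++ r2 ++ r3) x x).
Proof. by have [H [dot [pi [hd hp _]]]] := hA; exact: (rep_gram_mono hd hp). Qed.

Lemma gram_mask (I : Type) (r : seq I) (P : pred I) (x : I -> A) :
  rnorm (gram r (fun i => if P i then x i else 0) (fun i => if P i then x i else 0)) <=
  rnorm (gram r x x).
Proof.
have [H [dot [pi [hd hp _]]]] := hA.
apply: (gram_le hd hp) => [|h]; first exact: rnorm_ge0.
rewrite (le_trans _ (vsq_le_gram hd hp _ _ _)) //; apply: ler_sum => i _.
by case: ifP => // _; rewrite (rep0 hp) rnorm0 expr0n sqr_ge0.
Qed.

End GramEstimates.

(** * Block norms, completeness of l_2(A) and tails *)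

Section Blocks.
Variables (R : realType) (A : cstarAlgType R).
Hypothesis hA : wstar_algebra A.
Implicit Types (x y z : nat -> A) (a b : A) (m n i : nat).

(** Seminorm of the coordinates n <= i < m. It makes sense for every sequence, so it can be used to
    prove membership in [l2]. *)
Definition bnorm x n m : R := Num.sqrt (rnorm (gram (index_iota n m) x x)).

Lemma bnorm_ge0 x n m : 0 <= bnorm x n m.
Proof. exact: sqrtr_ge0. Qed.

Lemma bnorm_sqr x n m : bnorm x n m ^+ 2 = rnorm (gram (index_iota n m) x x).
Proof. by rewrite sqr_sqrtr ?rnorm_ge0. Qed.

Lemma bnorm_CS x y n m :
  rnorm (gram (index_iota n m) x y) <= bnorm x n m * bnorm y n m.
Proof. exact: gram_CS. Qed.

Lemma bnormD x y n m : bnorm (x + y) n m <= bnorm x n m + bnorm y n m.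
Proof.
apply: le_of_sqr; first by rewrite addr_ge0 ?bnorm_ge0.
rewrite bnorm_sqr; set r := index_iota n m.
have -> : gram r (x + y) (x + y) = (gram r x x + gram r x y) + (gram r y x + gram r y y).
  rewrite -!big_split /=; apply: eq_bigr => i _.
  by rewrite starD mulrDl !mulrDr.
have := rnormD (gram r x x + gram r x y) (gram r y x + gram r y y).
have := rnormD (gram r x x) (gram r x y); have := rnormD (gram r y x) (gram r y y).
have := bnorm_CS x y n m; have := bnorm_CS y x n m.
have := bnorm_sqr x n m; have := bnorm_sqr y n m; rewrite -/r => *; nra.
Qed.

Lemma bnorm_ract x a n m : bnorm (ract x a) n m <= bnorm x n m * rnorm a.
Proof.
apply: le_of_sqr; first by rewrite mulr_ge0 ?bnorm_ge0 ?rnorm_ge0.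
rewrite exprMn !bnorm_sqr; set r := index_iota n m.
have -> : gram r (ract x a) (ract x a) = star a * (gram r x x * a).
  rewrite mulr_suml mulr_sumr; apply: eq_bigr => i _.
  by rewrite /ract starM -!mulrA.
have := rnormM (star a) (gram r x x * a); have := rnormM (gram r x x) a.
rewrite rnorm_star; have := rnorm_ge0 a; have := rnorm_ge0 (gram r x x) => *; nra.
Qed.

Lemma bnormN x n m : bnorm (- x) n m = bnorm x n m.
Proof.
congr (Num.sqrt (rnorm _)); apply: eq_bigr => i _.
by rewrite -[(- x) i]/(- x i) starN mulrNN.
Qed.

Lemma bnorm0 n m : bnorm 0 n m = 0.
Proof. by rewrite /bnorm /gram big1 ?rnorm0 ?sqrtr0 // => i _; rewrite mulr0. Qed.

Lemma bnorm_geq x n m : (m <= n)%N -> bnorm x n m = 0.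
Proof. by move=> mn; rewrite /bnorm /gram big_geq // rnorm0 sqrtr0. Qed.

Lemma bnorm_mono x n m n' m' : (n' <= n)%N -> (m <= m')%N ->
  bnorm x n m <= bnorm x n' m'.
Proof.
move=> nn mm; have [nm|/ltnW mn] := leqP n m; last by rewrite bnorm_geq ?bnorm_ge0.
rewrite ler_sqrt ?rnorm_ge0 //.
have -> : index_iota n' m' = index_iota n' n ++ index_iota n m ++ index_iota m m'.
  rewrite /index_iota.
  have -> : (m' - n' = (n - n') + ((m - n) + (m' - m)))%N by lia.
  by rewrite !iotaD !subnKC.
exact: gram_mono.
Qed.

Lemma bnorm1 x n : bnorm x n n.+1 = rnorm (x n).
Proof.
by rewrite /bnorm /gram big_nat1 rnorm_cstar sqrtr_sqr ger0_norm ?rnorm_ge0.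
Qed.

Lemma bnorm_mask (P : pred nat) x n m :
  bnorm (fun i => if P i then x i else 0) n m <= bnorm x n m.
Proof. by rewrite ler_sqrt ?rnorm_ge0 // gram_mask. Qed.

Lemma bnorm_recr x m : bnorm x 0 m.+1 <= bnorm x 0 m + rnorm (x m).
Proof.
pose u i := if (i < m)%N then x i else 0.
pose v i := if (m <= i)%N then x i else 0.
have xE : x = u + v.
  apply/funext => i; rewrite -[RHS]/(u i + v i) /u /v.
  by case: ltnP => _; rewrite ?addr0 ?add0r.
rewrite {1}xE (le_trans (bnormD _ _ _ _)) // lerD //.
  rewrite le_eqVlt; apply/orP; left; apply/eqP; congr (Num.sqrt (rnorm _)).
  rewrite /gram big_nat_recr //= [u m](_ : _ = 0) ?mulr0 ?addr0 /u ?ltnn // !big_nat.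
  by apply: eq_bigr => i /andP[_ im]; rewrite /u im.
rewrite /bnorm /gram big_nat_recr //= big_nat big1 => [|i /andP[_ im]].
  by rewrite add0r /v leqnn rnorm_cstar sqrtr_sqr ger0_norm ?rnorm_ge0.
by rewrite /v leqNgt im mulr0.
Qed.

(** Cauchy criterion in the complete space A. One starting point [n] is enough, because blocks
    starting later are smaller by [bnorm_mono]. *)
Lemma l2_blocks x : l2 x <-> forall e : R, 0 < e ->
  exists n, forall m, bnorm x n m < e.
Proof.
pose s := series (fun i => star (x i) * x i).
have sB m n : (n <= m)%N -> rnorm (s m - s n) = bnorm x n m ^+ 2.
  by move=> nm; rewrite bnorm_sqr /s sub_series nm.
split=> [/cvgn_slim/slim_scauchy sc e e0|hx].
  have [|N NP] := sc (e ^+ 2); first exact: exprn_gt0.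
  exists N => m; have [Nm|/ltnW mN] := leqP N m; last by rewrite bnorm_geq.
  by apply: lt_of_sqr; rewrite ?(ltW e0) // -sB // NP.
have [|v vP] := @scauchy_slim _ _ s; last exact: slim_cvgn vP.
move=> e e0; have [|N NP] := hx (Num.sqrt e); first by rewrite sqrtr_gt0.
have aux m n : (N <= n)%N -> (n <= m)%N -> rnorm (s m - s n) < e.
  move=> Nn nm; rewrite sB // -(sqr_sqrtr (ltW e0)) ltr_sqr ?nnegrE ?bnorm_ge0 ?sqrtr_ge0 //.
  by rewrite (le_lt_trans _ (NP m)) // bnorm_mono.
exists N => m n Nm Nn; have [nm|/ltnW mn] := leqP n m; first exact: aux.
by rewrite rnorm_distC aux.
Qed.

Definition l2n x : R := Num.sqrt (rnorm (l2_ip x x)).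

Lemma l2_normE x : l2_norm x = (l2n x)%:C%C.
Proof. by rewrite /l2_norm /ip_norm rnormE sqrtC_real // rnorm_ge0. Qed.

Lemma l2n_ge0 x : 0 <= l2n x.
Proof. exact: sqrtr_ge0. Qed.

Lemma l2n_sqr x : l2n x ^+ 2 = rnorm (l2_ip x x).
Proof. by rewrite sqr_sqrtr ?rnorm_ge0. Qed.

Lemma slim_ip x y : l2 x -> l2 y ->
  slim (fun m => gram (index_iota 0 m) x y) (l2_ip x y).
Proof.
move=> lx ly; apply: cvgn_slim.
pose s := series (fun i => star (x i) * y i).
have [|v vP] := @scauchy_slim _ _ s; last exact: slim_cvgn vP.
move=> e e0; have [|N NP] := (l2_blocks x).1 lx (Num.sqrt e); first by rewrite sqrtr_gt0.
have [|N' N'P] := (l2_blocks y).1 ly (Num.sqrt e); first by rewrite sqrtr_gt0.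
have aux m n : (maxn N N' <= n)%N -> (n <= m)%N -> rnorm (s m - s n) < e.
  rewrite geq_max => /andP[Nn N'n] nm.
  rewrite /s sub_series nm (le_lt_trans (bnorm_CS _ _ _ _)) //.
  rewrite -(sqr_sqrtr (ltW e0)) expr2 ltr_pM ?bnorm_ge0 //.
    by rewrite (le_lt_trans _ (NP m)) // bnorm_mono.
  by rewrite (le_lt_trans _ (N'P m)) // bnorm_mono.
exists (maxn N N') => m n Nm Nn; have [nm|/ltnW mn] := leqP n m; first exact: aux.
by rewrite rnorm_distC aux.
Qed.

Lemma bnorm_le_l2n x n m : l2 x -> bnorm x n m <= l2n x.
Proof.
move=> lx; rewrite ler_sqrt ?rnorm_ge0 //; apply: slim_ge (slim_ip lx lx) _.
exists m => k mk; rewrite -!bnorm_sqr ler_sqr ?nnegrE ?bnorm_ge0 //.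
exact: bnorm_mono.
Qed.

Lemma l2n_le x (c : R) : l2 x -> 0 <= c -> (forall m, bnorm x 0 m <= c) -> l2n x <= c.
Proof.
move=> lx c0 hx; apply: le_of_sqr => //; rewrite l2n_sqr.
apply: slim_le (slim_ip lx lx) _; exists 0%N => m _.
by rewrite -bnorm_sqr ler_sqr ?nnegrE ?bnorm_ge0.
Qed.

Lemma l2n_coord x i : l2 x -> rnorm (x i) <= l2n x.
Proof. by move=> lx; rewrite -bnorm1 bnorm_le_l2n. Qed.

Lemma l20 : l2 (0 : nat -> A).
Proof. by apply/l2_blocks => e e0; exists 0%N => m; rewrite bnorm0. Qed.

Lemma l2D x y : l2 x -> l2 y -> l2 (x + y).
Proof.
move=> /l2_blocks lx /l2_blocks ly; apply/l2_blocks => e e0.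
have e2 : 0 < e / 2 by rewrite divr_gt0.
have [n nP] := lx _ e2; have [n' n'P] := ly _ e2.
exists (maxn n n') => m; rewrite (le_lt_trans (bnormD _ _ _ _)) // (splitr e) ltrD //.
  by rewrite (le_lt_trans _ (nP m)) // bnorm_mono // leq_maxl.
by rewrite (le_lt_trans _ (n'P m)) // bnorm_mono // leq_maxr.
Qed.

Lemma l2_ract x a : l2 x -> l2 (ract x a).
Proof.
move=> /l2_blocks lx; apply/l2_blocks => e e0.
have c0 : 0 < rnorm a + 1 by rewrite ltr_wpDl ?rnorm_ge0.
have [|n nP] := lx (e / (rnorm a + 1)); first by rewrite divr_gt0.
exists n => m; rewrite (le_lt_trans (bnorm_ract _ _ _ _)) //.
have := nP m; rewrite ltr_pdivlMr // mulrDr mulr1; apply: le_lt_trans.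
by rewrite lerDl bnorm_ge0.
Qed.

Lemma l2N x : l2 x -> l2 (- x).
Proof.
move=> /l2_blocks lx; apply/l2_blocks => e e0; have [n nP] := lx e e0.
by exists n => m; rewrite bnormN.
Qed.

Lemma l2B x y : l2 x -> l2 y -> l2 (x - y).
Proof. by move=> lx ly; apply: l2D (l2N _). Qed.

Lemma l2_mask (P : pred nat) x : l2 x -> l2 (fun i => if P i then x i else 0).
Proof.
move=> /l2_blocks lx; apply/l2_blocks => e e0; have [n nP] := lx e e0.
by exists n => m; rewrite (le_lt_trans _ (nP m)) // bnorm_mask.
Qed.

Lemma l2n_mask (P : pred nat) x : l2 x -> l2n (fun i => if P i then x i else 0) <= l2n x.
Proof.
move=> lx; apply: l2n_le => [||m]; [exact: l2_mask | exact: l2n_ge0 |].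
by rewrite (le_trans (bnorm_mask _ _ _ _)) // bnorm_le_l2n.
Qed.

Lemma l2nD x y : l2 x -> l2 y -> l2n (x + y) <= l2n x + l2n y.
Proof.
move=> lx ly; apply: l2n_le (l2D lx ly) _ _ => [|m]; first by rewrite addr_ge0 ?l2n_ge0.
by rewrite (le_trans (bnormD _ _ _ _)) // lerD ?bnorm_le_l2n.
Qed.

Lemma l2nN x : l2 x -> l2n (- x) = l2n x.
Proof.
have le y : l2 y -> l2n (- y) <= l2n y.
  move=> ly; apply: l2n_le (l2N ly) (l2n_ge0 _) _ => m.
  by rewrite bnormN bnorm_le_l2n.
by move=> lx; apply/le_anti; rewrite le //= -{1}(opprK x) le //; exact: l2N.
Qed.

Lemma l2nB x y : l2 x -> l2 y -> l2n (x - y) <= l2n x + l2n y.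
Proof. by move=> lx ly; rewrite -(l2nN ly) l2nD //; exact: l2N. Qed.

Lemma l2n_ract x a : l2 x -> l2n (ract x a) <= l2n x * rnorm a.
Proof.
move=> lx; apply: l2n_le (l2_ract lx) _ _ => [|m].
  by rewrite mulr_ge0 ?l2n_ge0 ?rnorm_ge0.
by rewrite (le_trans (bnorm_ract _ _ _ _)) // ler_wpM2r ?rnorm_ge0 ?bnorm_le_l2n.
Qed.

Lemma l2n0 : l2n (0 : nat -> A) = 0.
Proof.
apply/le_anti; rewrite l2n_ge0 andbT.
by apply: l2n_le l20 (lexx _) _ => m; rewrite bnorm0.
Qed.

Lemma l2n_eq0 x : l2 x -> l2n x = 0 -> x = 0.
Proof.
move=> lx x0; apply/funext => i; apply/rnorm0_eq0/le_anti.
by rewrite rnorm_ge0 andbT -x0 l2n_coord.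
Qed.

Lemma l2_complete (u : nat -> nat -> A) : (forall n, l2 (u n)) ->
  (forall e : R, 0 < e -> exists N, forall m n, (N <= m)%N -> (N <= n)%N ->
     l2n (u m - u n) < e) ->
  exists2 x, l2 x & forall e : R, 0 < e -> exists N, forall n, (N <= n)%N ->
    l2n (u n - x) < e.
Proof.
move=> lu cu.
have /choice[x xP] i : exists v, slim (fun n => u n i) v.
  apply: scauchy_slim => e /cu[N NP]; exists N => m n Nm Nn.
  rewrite (le_lt_trans _ (NP m n Nm Nn)) //.
  by have := l2n_coord i (l2B (lu m) (lu n)).
have fin (b : nat) (e : R) : 0 < e -> exists M, forall m, (M <= m)%N -> bnorm (u m - x) 0 b < e.
  elim: b e => [|b IH] e e0; first by exists 0%N => m _; rewrite bnorm_geq.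
  have e2 : 0 < e / 2 by rewrite divr_gt0.
  have [M MP] := IH _ e2; have [M' M'P] := xP b _ e2.
  exists (maxn M M') => m; rewrite geq_max => /andP[Mm M'm].
  by rewrite (le_lt_trans (bnorm_recr _ _)) // (splitr e) ltrD ?MP //; exact: M'P.
(* The bound must not depend on [b]: for each [b] the index [k] is taken so late that u_k is close
   to x on the first b coordinates, while u_n - u_k is small in all of l_2(A). *)
have close (e : R) : 0 < e -> exists N, forall n, (N <= n)%N -> forall b : nat, bnorm (u n - x) 0 b <= e.
  move=> e0; have [N NP] := cu e e0; exists N => n Nn b.
  apply/ler_addgt0Pr => d /(fin b)[M MP].
  have := MP _ (leq_maxl M N); have := NP n _ Nn (leq_maxr M N).
  set k := maxn M N => h1 h2.
  have -> : u n - x = (u n - u k) + (u k - x) by rewrite addrA subrK.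
  rewrite (le_trans (bnormD _ _ _ _)) // lerD ?(ltW h2) //.
  by rewrite (le_trans (bnorm_le_l2n _ _ (l2B (lu n) (lu k)))) // ltW.
have lx : l2 x.
  apply/l2_blocks => e e0; have e2 : 0 < e / 2 by rewrite divr_gt0.
  have [N NP] := close _ e2.
  have [n nP] := (l2_blocks (u N)).1 (lu N) _ e2; exists n => m.
  have -> : x = - (u N - x) + u N by rewrite opprB subrK.
  rewrite (le_lt_trans (bnormD _ _ _ _)) // (splitr e) ler_ltD //.
  by rewrite bnormN (le_trans _ (NP N (leqnn _) m)) // bnorm_mono.
exists x => // e e0; have e2 : 0 < e / 2 by rewrite divr_gt0.
have [N NP] := close _ e2; exists N => n Nn.
rewrite (@le_lt_trans _ _ (e / 2)) ?ltr_pdivrMr ?ltr_pMr ?ltr1n //.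
by apply: l2n_le (l2B (lu n) lx) (ltW e2) _; exact: NP.
Qed.

(** The coordinate projection q_m. *)
Definition tail m x : nat -> A := fun i => if (m <= i)%N then x i else 0.

Lemma l2_tail m x : l2 x -> l2 (tail m x).
Proof. exact: l2_mask. Qed.

Lemma l2n_tail m x : l2 x -> l2n (tail m x) <= l2n x.
Proof. exact: l2n_mask. Qed.

Lemma tail_small x (e : R) : l2 x -> 0 < e ->
  exists N, forall m, (N <= m)%N -> l2n (tail m x) < e.
Proof.
move=> lx e0; have e2 : 0 < e / 2 by rewrite divr_gt0.
have [N NP] := (l2_blocks x).1 lx _ e2; exists N => m Nm.
rewrite (@le_lt_trans _ _ (e / 2)) ?ltr_pdivrMr ?ltr_pMr ?ltr1n //.
apply: l2n_le (l2_tail lx) (ltW e2) _ => k.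
rewrite (@le_trans _ _ (bnorm x m k)) //; last first.
  by rewrite (le_trans _ (ltW (NP k))) // bnorm_mono.
have [mk|/ltnW km] := leqP m k; last first.
  rewrite [leRHS]bnorm_geq // /bnorm /gram big_nat big1 ?rnorm0 ?sqrtr0 // => i /andP[_ ik].
  by rewrite /tail leqNgt (leq_trans ik km) mulr0.
rewrite ler_sqrt ?rnorm_ge0 // le_eqVlt; apply/orP; left; apply/eqP; congr rnorm.
rewrite /gram (@big_cat_nat _ _ _ m) //= [X in X + _]big_nat big1 => [|i /andP[_ im]].
  by rewrite add0r !big_nat; apply: eq_bigr => i /andP[mi _]; rewrite /tail mi.
by rewrite /tail leqNgt im mulr0.
Qed.

End Blocks.

(** * Neumann series and the open mapping principle *)

(** The norm is a bare function on a subset of a module, so that one theory applies to [l2], to its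
    closed submodules and to A. Only real scalars are asked for. *)
Record complete_normed (R : realType) (V : lmodType R[i]) (D : set V) (N : V -> R)
  : Prop := {
  cn0 : D 0;
  cnD : forall x y, D x -> D y -> D (x + y);
  cnZ : forall (t : R) x, D x -> D (t%:C%C *: x);
  cn_ge0 : forall x, D x -> 0 <= N x;
  cn_tri : forall x y, D x -> D y -> N (x + y) <= N x + N y;
  cn_scale : forall (t : R) x, D x -> N (t%:C%C *: x) = `|t| * N x;
  cn_definite : forall x, D x -> N x = 0 -> x = 0;
  cn_complete : forall u : nat -> V, (forall n, D (u n)) ->
    (forall e : R, 0 < e -> exists k, forall m n, (k <= m)%N -> (k <= n)%N ->
       N (u m - u n) < e) ->
    exists2 x, D x & forall e : R, 0 < e -> exists k, forall n, (k <= n)%N ->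
      N (x - u n) < e
}.

Lemma half_pow_small (R : realType) (c e : R) : 0 < e ->
  exists k, forall n, (k <= n)%N -> c * 2^-1 ^+ n < e.
Proof.
move=> e0; have c0 : 0 < `|c| + 1 by rewrite ltr_wpDl.
have /cvgrPdist_lt/(_ _ (divr_gt0 e0 c0))[k _ kP] : (fun n => 2^-1 ^+ n : R) @ \oo --> (0 : R).
  by apply: cvg_expr; rewrite ger0_norm // invf_lt1 ?ltr1n.
exists k => n /kP; rewrite /= sub0r normrN ger0_norm ?exprn_ge0 //.
rewrite ltr_pdivlMr // mulrC; apply: le_lt_trans.
rewrite ler_wpM2r ?exprn_ge0 //.
by rewrite (le_trans (ler_norm c)) // lerDl.
Qed.

Section CompleteNormed.
Variables (R : realType) (V : lmodType R[i]) (D : set V) (N : V -> R).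
Hypothesis cn : complete_normed D N.
Implicit Types (x y : V) (c e r t : R).

Let D0 := cn0 cn.
Let DD := cnD cn.
Let DZ := cnZ cn.
Let N_ge0 := cn_ge0 cn.
Let N_tri := cn_tri cn.

Lemma cn_opp x : D x -> D (- x).
Proof. by move=> /(DZ (-1)); rewrite rmorphN rmorph1 scaleN1r. Qed.

Lemma cn_sub x y : D x -> D y -> D (x - y).
Proof. by move=> Dx Dy; apply: DD (cn_opp _). Qed.

Lemma cnN x : D x -> N (- x) = N x.
Proof. by move=> /(cn_scale cn (-1)); rewrite rmorphN rmorph1 scaleN1r normrN1 mul1r. Qed.

Lemma cn_norm0 : N 0 = 0.
Proof. by have := cn_scale cn 0 D0; rewrite normr0 mul0r scaler0. Qed.

Lemma cn_distC x y : D x -> D y -> N (x - y) = N (y - x).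
Proof. by move=> Dx Dy; rewrite -cnN ?opprB //; exact: cn_sub. Qed.

Lemma cn_dist3 y x z : D x -> D y -> D z -> N (x - z) <= N (x - y) + N (y - z).
Proof.
move=> Dx Dy Dz; rewrite -{1}(subrK y x) -addrA.
by apply: N_tri; exact: cn_sub.
Qed.

Lemma cn_eq x y : D x -> D y -> (forall e, 0 < e -> N (x - y) <= e) -> x = y.
Proof.
move=> Dx Dy xy; apply/eqP; rewrite -subr_eq0; apply/eqP.
have Dxy := cn_sub Dx Dy.
apply: (cn_definite cn) => //; apply/le_anti; rewrite N_ge0 // andbT.
by apply/ler_addgt0Pr => e e0; rewrite add0r xy.
Qed.

Lemma cn_sum (u : nat -> V) n : (forall k, D (u k)) -> D (\sum_(k < n) u k).
Proof. by move=> Du; elim/big_ind: _. Qed.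

Lemma geometric_series (y : nat -> V) c : (forall k, D (y k)) ->
  (forall k, N (y k) <= c * 2^-1 ^+ k) ->
  exists x, [/\ D x, N x <= 2 * c &
    forall e, 0 < e -> exists k, forall n, (k <= n)%N ->
      N (x - \sum_(k < n) y k) < e].
Proof.
move=> Dy hy; pose S n := \sum_(k < n) y k.
have DS n : D (S n) by exact: cn_sum.
(* Keeping the subtracted term 2^-m makes the induction on m close exactly. *)
have dS n m : (n <= m)%N -> N (S m - S n) <= 2 * c * (2^-1 ^+ n - 2^-1 ^+ m).
  move=> /subnK <-; elim: (m - n)%N => [|k IH].
    by rewrite !subrr cn_norm0 mulr0.
  rewrite addSn; set p := (k + n)%N in IH *.
  have Sp : S p.+1 - S p = y p by rewrite /S big_ord_recr /= addrAC subrr add0r.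
  have := cn_dist3 (DS p.+1) (DS p) (DS n); rewrite Sp exprSr => h.
  have aux (a b q s t : R) : a <= b + q -> b <= c * s -> q <= 2 * c * (t - s) ->
    a <= 2 * c * (t - s * 2^-1) by move=> *; lra.
  exact: aux h (hy p) IH.
have c0 : 0 <= c by have := le_trans (N_ge0 (Dy 0%N)) (hy 0%N); rewrite expr0 mulr1.
have bS n m : (n <= m)%N -> N (S m - S n) <= 2 * c * 2^-1 ^+ n.
  move=> nm; rewrite (le_trans (dS _ _ nm)) // ler_wpM2l ?mulr_ge0 //.
  by rewrite gerBl exprn_ge0.
have [|x Dx xP] := cn_complete cn DS.
  move=> e /(half_pow_small (2 * c))[k kP]; exists k => m n km kn.
  have [nm|/ltnW mn] := leqP n m; first by rewrite (le_lt_trans (bS _ _ nm)) // kP.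
  by rewrite cn_distC // (le_lt_trans (bS _ _ mn)) // kP.
exists x; split=> //; apply/ler_addgt0Pr => e /xP[k kP].
rewrite -(subrK (S k) x) (le_trans (N_tri (cn_sub Dx (DS k)) (DS k))) // addrC.
rewrite lerD ?(ltW (kP _ _)) //.
have := bS 0%N k (leq0n k).
by rewrite /S big_ord0 subr0 expr0 mulr1.
Qed.

Lemma neumann_series (E : V -> V) x : (forall y, D y -> D (E y)) ->
  (forall y z, D y -> D z -> E (y - z) = E y - E z) ->
  (forall y, D y -> N (E y) <= 2^-1 * N y) ->
  D x -> exists2 y, D y & y - E y = x.
Proof.
move=> DE Esub NE Dx.
have E0 : E 0 = 0 by rewrite -(subrr 0) Esub ?subrr.
have EN y : D y -> E (- y) = - E y.
  by move=> Dy; rewrite -sub0r Esub // E0 sub0r.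
have EDd y z : D y -> D z -> E (y + z) = E y + E z.
  by move=> Dy Dz; rewrite -{1}(opprK z) Esub ?EN ?opprK //; exact: cn_opp.
pose u k := iter k E x.
have Du k : D (u k) by elim: k => //= k IH; exact: DE.
have Nu k : N (u k) <= N x * 2^-1 ^+ k.
  elim: k => [|k IH]; first by rewrite expr0 mulr1.
  rewrite (le_trans (NE _ (Du k))) // exprS mulrCA ler_wpM2l //.
have [y [Dy _ hy]] := geometric_series Du Nu.
have ES n : E (\sum_(k < n) u k) = \sum_(k < n) u k.+1.
  elim: n => [|n IH]; first by rewrite !big_ord0.
  by rewrite !big_ord_recr /= EDd ?IH //; exact: cn_sum.
have DEy := DE _ Dy.
have Dyy := cn_sub Dy DEy; exists y => //; apply: (cn_eq Dyy Dx) => e e0.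
have [k kP] := hy (e / 2) (divr_gt0 e0 (ltr0Sn _ 1)).
pose S n := \sum_(k < n) u k.
have DS n : D (S n) by exact: cn_sum.
have -> : y - E y - x = (y - S k.+1) + E (S k - y).
  have -> : S k.+1 = x + E (S k) by rewrite /S ES big_ord_recl.
  by rewrite Esub // opprD [RHS]addrA (addrA y) subrK addrAC.
have Dd n : D (y - S n) by exact: cn_sub.
have Dd' : D (S k - y) by exact: cn_sub.
rewrite (le_trans (N_tri _ (DE _ _))) //.
have := kP k.+1 (leqnSn k); have := kP k (leqnn k); have := NE _ Dd'.
rewrite (cn_distC (DS k) Dy) -!/(S _); have := N_ge0 (Dd k).
move: (N _) (N _) (N _) => *; lra.
Qed.

Section Gauge.
(* [gauge x r]: the vector [x] has a representation of size at most [r]. *)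
Variable gauge : V -> R -> Prop.
Hypothesis gauge_ex : forall x, D x -> exists r, gauge x r.
Hypothesis gauge_mono : forall x r s, gauge x r -> r <= s -> gauge x s.
Hypothesis gauge_sub : forall x y r s, gauge x r -> gauge y s -> gauge (x - y) (r + s).
Hypothesis gauge_scale : forall x r t, gauge x r -> 0 <= t ->
  gauge (t%:C%C *: x) (t * r).
Hypothesis gauge_series : forall (y : nat -> V) c x, D x -> (forall k, D (y k)) ->
  (forall k, gauge (y k) (c * 2^-1 ^+ k)) ->
  (forall e, 0 < e -> exists k, forall n, (k <= n)%N -> N (x - \sum_(k < n) y k) < e) ->
  gauge x (2 * c).

(** Baire's argument: the sets {gauge <= n} exhaust D. If none were dense in a ball, nested
    shrinking balls could avoid them one after another, and the common point would have no gauge at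
    all. *)
Lemma gauge_dense_ball : exists (n : nat) (x0 : V) (r : R), [/\ D x0, 0 < r &
  forall x, D x -> N (x - x0) < r -> forall e, 0 < e ->
    exists y, [/\ D y, N (y - x) < e & gauge y n%:R]].
Proof.
apply: contrapT => hno.
have step (n : nat) (p : V * R) : exists q : V * R, D p.1 -> 0 < p.2 ->
    [/\ D q.1, 0 < q.2, q.2 <= 2^-1 * p.2, N (q.1 - p.1) + q.2 <= p.2 &
        forall y, D y -> N (y - q.1) <= q.2 -> ~ gauge y n%:R].
  case: p => x0 r /=; have [[Dx0 r0]|h] := pselect (D x0 /\ 0 < r); last first.
    by exists (0, 0) => Dx0 r0; case: h.
  apply: contrapT => hq; apply: hno; exists n, x0, (2^-1 * r).
  split; rewrite ?mulr_gt0 // => x Dx xr e e0; apply: contrapT => hy.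
  (* Half of r keeps the new closed ball inside the old one; half of e keeps it away from the
     vectors of gauge n. *)
  apply: hq; exists (x, Num.min (2^-1 * r) (2^-1 * e)) => _ _ /=.
  have m1 : Num.min (2^-1 * r) (2^-1 * e) <= 2^-1 * r by rewrite ge_min lexx.
  have m2 : Num.min (2^-1 * r) (2^-1 * e) <= 2^-1 * e by rewrite ge_min lexx orbT.
  split=> //; first by rewrite lt_min !mulr_gt0.
    by move: xr m1; set w := N _; set w' := Num.min _ _ => *; lra.
  move=> y Dy ym gy; apply: hy; exists y; split=> //.
  by rewrite (le_lt_trans ym) // (le_lt_trans m2) // gtr_pMl // invf_lt1 ?ltr1n.
have /choice[f fP] (np : nat * (V * R)) : exists q : V * R, D np.2.1 -> 0 < np.2.2 ->
    [/\ D q.1, 0 < q.2, q.2 <= 2^-1 * np.2.2, N (q.1 - np.2.1) + q.2 <= np.2.2 &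
        forall y, D y -> N (y - q.1) <= q.2 -> ~ gauge y np.1%:R].
  exact: step.
pose b := fix b n : V * R := if n is n'.+1 then f (n', b n') else (0, 1).
have bD n : D (b n).1 /\ 0 < (b n).2.
  by elim: n => [|n [Dn rn]] //=; have [] := fP (n, b n) Dn rn.
have bS n : [/\ (b n.+1).2 <= 2^-1 * (b n).2,
    N ((b n.+1).1 - (b n).1) + (b n.+1).2 <= (b n).2 &
    forall y, D y -> N (y - (b n.+1).1) <= (b n.+1).2 -> ~ gauge y n%:R].
  by have [Dn rn] := bD n; have [] := fP (n, b n) Dn rn.
have br n : (b n).2 <= 1 * 2^-1 ^+ n.
  elim: n => [|n IH] /=; first by rewrite mulr1.
  have [+ _ _] := bS n; rewrite exprS => /le_trans; apply.
  by rewrite mulrCA ler_wpM2l.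
have nest n m : (n <= m)%N -> N ((b m).1 - (b n).1) + (b m).2 <= (b n).2.
  move=> /subnK <-; elim: (m - n)%N => [|k IH]; first by rewrite subrr cn_norm0 add0r.
  rewrite addSn; set p := (k + n)%N in IH *.
  have [_ + _] := bS p.
  have := cn_dist3 (bD p.+1).1 (bD p).1 (bD n).1.
  move: IH; move: (N _) (N _) (N _) => *; lra.
have [|x Dx xP] := cn_complete cn (fun n => (bD n).1).
  move=> e /(half_pow_small 1)[k kP]; exists k => m n km kn.
  have aux i j : (k <= i)%N -> (i <= j)%N -> N ((b j).1 - (b i).1) < e.
    move=> ki ij; have := nest _ _ ij; have := br i; have := kP i ki.
    have := (bD j).2; move: (N _) (_ * _ ^+ _) => *; lra.
  have [nm|/ltnW mn] := leqP n m; first exact: aux.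
  by rewrite (cn_distC (bD m).1 (bD n).1) aux.
have xb n : N (x - (b n).1) <= (b n).2.
  apply/ler_addgt0Pr => e /xP[k kP].
  have := nest _ _ (leq_maxl n k); have := kP _ (leq_maxr n k); set m := maxn n k.
  have := cn_dist3 Dx (bD m).1 (bD n).1; have := (bD m).2.
  move: (N _) (N _) (N _) => *; lra.
have [r gr] := gauge_ex Dx.
have [_ _ /(_ x Dx (xb _))] := bS (Num.truncn r).+1; apply.
by apply: gauge_mono gr _; rewrite ltW // truncnS_gt.
Qed.

(** Subtracting two approximants moves the dense ball to the origin and doubles n. Scaling then
    approximates every vector up to half its size, and iterating on the remainders gives a geometric
    series. *)
Lemma gauge_bounded : exists2 C : R, 0 <= C & forall x, D x -> gauge x (C * N x).
Proof.
have [n [x0 [r [Dx0 r0 hx0]]]] := gauge_dense_ball.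
have near0 x e : D x -> N x < r -> 0 < e ->
    exists y, [/\ D y, N (y - x) < e & gauge y (n%:R + n%:R)].
  move=> Dx xr e0; have e2 : 0 < e / 2 by rewrite divr_gt0.
  have [||y1 [Dy1 y1e g1]] := hx0 (x0 + x) _ _ _ e2; [exact: DD | by rewrite addrC addKr|].
  have [||y2 [Dy2 y2e g2]] := hx0 x0 _ _ _ e2; rewrite ?subrr ?cn_norm0 //.
  exists (y1 - y2); split; [exact: cn_sub | | exact: gauge_sub].
  have -> : y1 - y2 - x = (y1 - (x0 + x)) - (y2 - x0).
    by rewrite opprB (addrC x0 x) opprD (addrA y1) [RHS]addrA subrK addrAC.
  have Da : D (y1 - (x0 + x)) by apply: cn_sub => //; exact: DD.
  have Db : D (y2 - x0) by exact: cn_sub.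
  rewrite (le_lt_trans (N_tri Da (cn_opp Db))) // cnN //; lra.
(* A vector of size d is divided by t = 2 d / r to enter the ball of radius r; the gauge 2 n is then
   multiplied by t. The precision r/4 used below becomes d/2 after rescaling. *)
pose C := 4 * n%:R / r.
have C0 : 0 <= C by rewrite divr_ge0 ?mulr_ge0 // ltW.
have approx x d : D x -> 0 < d -> N x <= d ->
    exists y, [/\ D y, N (x - y) <= 2^-1 * d & gauge y (C * d)].
  move=> Dx d0 xd; pose t := 2 * d / r.
  have t0 : 0 < t by rewrite divr_gt0 ?mulr_gt0.
  have tx : D ((t^-1)%:C%C *: x) by exact: DZ.
  have [||y [Dy ye gy]] := near0 _ (r / 4) tx; last first.
  - exists (t%:C%C *: y); split; first exact: DZ.
      rewrite cn_distC //; last exact: DZ.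
      have -> : t%:C%C *: y - x = t%:C%C *: (y - (t^-1)%:C%C *: x).
        by rewrite scalerBr scalerA -rmorphM divff ?gt_eqF // rmorph1 scale1r.
      rewrite (cn_scale cn t (cn_sub Dy tx)) (ger0_norm (ltW t0)).
      have -> : 2^-1 * d = t * (r / 4) by rewrite /t; field; rewrite gt_eqF.
      by rewrite ler_pM2l // ltW.
    have -> : C * d = t * (n%:R + n%:R) by rewrite /C /t; field; rewrite gt_eqF.
    by apply: gauge_scale gy _; exact: ltW.
  - by rewrite divr_gt0.
  rewrite (cn_scale cn) // ger0_norm ?invr_ge0 ?(ltW t0) // mulrC ltr_pdivrMr //.
  rewrite (_ : r * t = 2 * d); last by rewrite /t; field; rewrite gt_eqF.
  by rewrite (le_lt_trans xd) // ltr_pMl // ltr1n.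
exists (2 * C) => [|x Dx]; first by rewrite mulr_ge0.
have [x0'|xn0] := eqVneq (N x) 0.
  rewrite x0' mulr0 (cn_definite cn Dx x0').
  have [s gs] := gauge_ex D0.
  by have := gauge_scale gs (lexx 0); rewrite scaler0 mul0r.
have xp : 0 < N x by rewrite lt_def xn0 N_ge0.
have /choice[g gP] (xd : V * R) : exists y, D xd.1 -> 0 < xd.2 -> N xd.1 <= xd.2 ->
    [/\ D y, N (xd.1 - y) <= 2^-1 * xd.2 & gauge y (C * xd.2)].
  have [[h1 h2 h3]|h] := pselect [/\ D xd.1, 0 < xd.2 & N xd.1 <= xd.2].
    by have [y yP] := approx _ _ h1 h2 h3; exists y.
  by exists 0 => *; case: h.
pose d k := N x * 2^-1 ^+ k.
have d0 k : 0 < d k by rewrite mulr_gt0 ?exprn_gt0.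
pose res := fix res k := if k is k'.+1 then res k' - g (res k', d k') else x.
have resP k : D (res k) /\ N (res k) <= d k.
  elim: k => [|k [Dk Nk]] /=; first by rewrite /d mulr1.
  have [Dy Ny _] := gP (res k, d k) Dk (d0 k) Nk.
  by split; [exact: cn_sub | rewrite /d exprS mulrCA].
pose y k := g (res k, d k).
have yP k : D (y k) /\ gauge (y k) (C * N x * 2^-1 ^+ k).
  have [Dk Nk] := resP k; have [Dy Ny gy] := gP (res k, d k) Dk (d0 k) Nk.
  by split=> //; rewrite -mulrA.
rewrite -mulrA; apply: (@gauge_series y) => // [k|k|e e0]; [exact: (yP k).1|exact: (yP k).2|].
have [k kP] := half_pow_small (N x) e0; exists k => m km.
have -> : x - \sum_(k < m) y k = res m.
  elim: m {km} => [|m IH]; first by rewrite big_ord0 subr0.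
  by rewrite big_ord_recr /= opprD addrA IH.
by rewrite (le_lt_trans (resP m).2) // kP.
Qed.

End Gauge.
End CompleteNormed.

(** * The standard inner product, closed submodules and tail submodules *)

Section L2InnerProduct.
Variables (R : realType) (A : cstarAlgType R).
Hypothesis hA : wstar_algebra A.
Implicit Types (x y z : nat -> A) (a b : A) (m n i : nat).

Lemma l2_ipDr x y z : l2 x -> l2 y -> l2 z -> l2_ip x (y + z) = l2_ip x y + l2_ip x z.
Proof.
move=> lx ly lz; apply: (slim_unique (slim_ip hA lx (l2D hA ly lz))).
have := slimD (slim_ip hA lx ly) (slim_ip hA lx lz).
congr slim; apply/funext => m; rewrite -big_split; apply: eq_bigr => i _.
exact/esym/mulrDr.
Qed.

Lemma l2_ip_ract x y a : l2 x -> l2 y -> l2_ip x (ract y a) = l2_ip x y * a.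
Proof.
move=> lx ly; apply: (slim_unique (slim_ip hA lx (l2_ract hA ly))).
have -> : (fun m => gram (index_iota 0 m) x (ract y a)) =
    (fun m => gram (index_iota 0 m) x y * a).
  apply/funext => m; rewrite mulr_suml; apply: eq_bigr => i _.
  by rewrite /ract mulrA.
apply: (@slim_image _ _ _ (fun b => b * a) (rnorm a)) (slim_ip hA lx ly) => u v.
by rewrite -mulrBl mulrC rnormM.
Qed.

Lemma l2_ip_star x y : l2 x -> l2 y -> star (l2_ip x y) = l2_ip y x.
Proof.
move=> lx ly; apply: (slim_unique _ (slim_ip hA ly lx)).
under eq_fun do rewrite -star_gram.
apply: (slim_image (c := 1)) (slim_ip hA lx ly) => u v.
by rewrite -starN -starD rnorm_star mul1r.
Qed.

(** The quadratic form of the limit is a limit of forms [vsq], hence nonnegative; the square root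
    then supplies the witness. *)
Lemma l2_ip_nneg x : l2 x -> cstar_nneg (l2_ip x x).
Proof.
move=> lx; have [H [dot [pi [hd hp _]]]] := hA.
apply: (cstar_nneg_rep hd hp) => [|h]; first exact: l2_ip_star.
apply/ler_addgt0Pr => e e0.
have c0 : 0 < rnorm h ^+ 2 + 1 by rewrite ltr_wpDl ?sqr_ge0.
have [N NP] := slim_ip hA lx lx (divr_gt0 e0 c0).
have := vsq_ge0 pi (index_iota 0 N) x h; rewrite -(rdot_gram_vsq hd hp).
have := NP N (leqnn N); set g := gram _ _ _; rewrite ltr_pdivlMr // => ge.
have : rdot dot (pi (g - l2_ip x x) h) h <= rnorm (g - l2_ip x x) * rnorm h ^+ 2.
  rewrite (le_trans (rdot_CS hd _ _)) // expr2 mulrA.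
  by rewrite ler_wpM2r ?rnorm_ge0 ?(rep_norm_le hp).
rewrite (repB hp) rdotBl; have := rnorm_ge0 (g - l2_ip x x); move: ge.
move: (rnorm (g - _)) (rdot _ _ _) (rdot _ _ _) (_ ^+ 2) => p q r s.
by move=> *; lra.
Qed.

Lemma l2_finsupp m x : (forall i, (m <= i)%N -> x i = 0) -> l2 x.
Proof.
move=> x0; apply/l2_blocks => // e e0; exists m => k.
by rewrite /bnorm /gram big_nat big1 ?rnorm0 ?sqrtr0 // => i /andP[/x0-> _]; rewrite mulr0.
Qed.

Lemma l2_ip_finsupp m x y : l2 x -> (forall i, (m <= i)%N -> y i = 0) ->
  l2_ip x y = gram (index_iota 0 m) x y.
Proof.
move=> lx y0; apply: (slim_unique (slim_ip hA lx (l2_finsupp y0))) => e e0.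
exists m => k mk.
have -> : gram (index_iota 0 k) x y = gram (index_iota 0 m) x y.
  rewrite {1}/gram (@big_cat_nat _ _ _ m) //= [X in _ + X](_ : _ = 0) ?addr0 //.
  by rewrite big_nat big1 // => i /andP[/y0-> _]; rewrite mulr0.
by rewrite subrr rnorm0.
Qed.

Lemma realZ_ract (t : R) x : t%:C%C *: x = ract x (t%:C%C *: (1 : A)).
Proof. by apply/funext => i; rewrite /ract scaler_mulr mulr1. Qed.

Lemma ractDl x y a : ract (x + y) a = ract x a + ract y a.
Proof. by apply/funext => i; exact: mulrDl. Qed.

Lemma ractDr x a b : ract x (a + b) = ract x a + ract x b.
Proof. by apply/funext => i; exact: mulrDr. Qed.

Lemma ractN1 x : ract x (-1) = - x.
Proof. by apply/funext => i; rewrite /ract mulrN1. Qed.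

Lemma bnorm_scale (t : R) x n m : bnorm (t%:C%C *: x) n m = `|t| * bnorm x n m.
Proof.
rewrite /bnorm; have -> : gram (index_iota n m) (t%:C%C *: x) (t%:C%C *: x) =
    (t ^+ 2)%:C%C *: gram (index_iota n m) x x.
  rewrite /gram scaler_sumr; apply: eq_bigr => i _.
  rewrite -[(t%:C%C *: x) i]/(t%:C%C *: x i) starZr scaler_mull scaler_mulr scalerA.
  by rewrite -rmorphM expr2.
by rewrite rnormZ sqrtrM ?normr_ge0 // normrX sqrtr_sqr normr_id.
Qed.

Lemma l2Z (t : R) x : l2 x -> l2 (t%:C%C *: x).
Proof. by rewrite realZ_ract; exact: l2_ract. Qed.

Lemma l2n_scale (t : R) x : l2 x -> l2n (t%:C%C *: x) = `|t| * l2n x.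
Proof.
have le s y : l2 y -> l2n (s%:C%C *: y) <= `|s| * l2n y.
  move=> ly; apply: (l2n_le hA (l2Z (t := s) ly)) => [|m]; first by rewrite mulr_ge0 ?l2n_ge0.
  by rewrite bnorm_scale ler_wpM2l // bnorm_le_l2n.
move=> lx; apply/le_anti; rewrite le //=.
have [->|t0] := eqVneq t 0; first by rewrite normr0 mul0r l2n_ge0.
have := le t^-1 _ (l2Z (t := t) lx).
rewrite scalerA -rmorphM mulVf // rmorph1 scale1r normfV mulrC ler_pdivlMr ?normr_gt0 //.
by rewrite mulrC.
Qed.

Lemma l2n_dist_lt x y (e : R) : (l2_norm (x - y) < e%:C%C) = (l2n (x - y) < e).
Proof. by rewrite l2_normE ltcR. Qed.

Lemma closed_submodule_complete M : closed_submodule M ->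
  complete_normed M (@l2n R A).
Proof.
move=> [Ml2 M0 MD Mr Mc]; split => //.
- by move=> t x Mx; rewrite realZ_ract; exact: Mr.
- by move=> x _; exact: l2n_ge0.
- by move=> x y /Ml2 lx /Ml2 ly; exact: l2nD.
- by move=> t x /Ml2; exact: l2n_scale.
- by move=> x /Ml2; exact: l2n_eq0.
move=> u Mu cu; have lu n := Ml2 _ (Mu n).
have [x lx xP] := l2_complete hA lu cu.
have xP' (e : R) : 0 < e -> exists k, forall n, (k <= n)%N -> l2n (x - u n) < e.
  move=> /xP[k kP]; exists k => n /kP.
  by rewrite -l2nN ?opprB //; exact: l2B.
exists x => //; apply: Mc; split=> // e e0.
have /complex_realP[e' ee'] : e \is Num.real by rewrite ger0_real // ltW.
have [|k kP] := xP' e'; first by rewrite -ltcR -ee'.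
by exists (u k); rewrite ?ee' ?l2n_dist_lt ?kP.
Qed.

Lemma l2_closed_submodule : closed_submodule (@l2 R A).
Proof.
split=> //; [exact: l20 | | | by move=> x []].
- by move=> x y; exact: l2D.
- by move=> x a; exact: l2_ract.
Qed.

Lemma algebra_complete : complete_normed [set: A] (@rnorm R A).
Proof.
split=> //.
- by move=> x _; exact: rnorm_ge0.
- by move=> x y _ _; exact: rnormD.
- by move=> t x _; exact: rnormZ.
- by move=> x _; exact: rnorm0_eq0.
move=> u _ /scauchy_slim[x xP]; exists x => // e /xP[k kP]; exists k => n /kP.
by rewrite rnorm_distC.
Qed.

Lemma tailD m x y : tail m (x + y) = tail m x + tail m y.
Proof.
apply/funext => i; rewrite -[RHS]/(tail m x i + tail m y i) /tail.
by case: ifP => // _; rewrite addr0.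
Qed.

Lemma tail_ract m x a : tail m (ract x a) = ract (tail m x) a.
Proof. by apply/funext => i; rewrite /tail /ract; case: ifP => // _; rewrite mul0r. Qed.

Lemma tailN m x : tail m (- x) = - tail m x.
Proof. by rewrite -!ractN1 tail_ract. Qed.

Lemma tailB m x y : tail m (x - y) = tail m x - tail m y.
Proof. by rewrite tailD tailN. Qed.

Lemma tail_idem m x : tail m (tail m x) = tail m x.
Proof. by apply/funext => i; rewrite /tail; case: (m <= i)%N. Qed.

Lemma tail0 m : tail m (0 : nat -> A) = 0.
Proof. by apply/funext => i; rewrite /tail; case: ifP. Qed.

Lemma tail_sum m (I : Type) (r : seq I) (F : I -> nat -> A) :
  tail m (\sum_(i <- r) F i) = \sum_(i <- r) tail m (F i).
Proof.
apply: (big_morph (tail m)) => [x y|]; first exact: tailD.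
exact: tail0.
Qed.

Definition tails m : set (nat -> A) := [set x | l2 x /\ tail m x = x].

Lemma tails_closed m : closed_submodule (tails m).
Proof.
split.
- by move=> x [].
- by split; [exact: l20 | exact: tail0].
- by move=> x y [lx tx] [ly ty]; split; [exact: l2D | rewrite tailD tx ty].
- by move=> x a [lx tx]; split; [exact: l2_ract | rewrite tail_ract tx].
move=> x [lx xP]; split=> //; apply/funext => i; rewrite /tail; case: leqP => // im.
apply/esym/rnorm0_eq0/le_anti; rewrite rnorm_ge0 andbT.
apply/ler_addgt0Pr => e e0; rewrite add0r.
have [|y [ly <-]] := xP e%:C%C; first by rewrite ltcR.
rewrite l2n_dist_lt => /ltW; apply: le_trans.
have := l2n_coord hA i (l2B hA lx (l2_tail hA (m := m) ly)).
by rewrite -[(x - _) i]/(x i - tail m y i) /tail leqNgt im subr0.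
Qed.

Lemma l2_sum (I : Type) (r : seq I) (F : I -> nat -> A) :
  (forall k, l2 (F k)) -> l2 (\sum_(i <- r) F i).
Proof.
move=> lF; elim: r => [|k r IH]; first by rewrite big_nil; exact: l20.
by rewrite big_cons; exact: l2D.
Qed.

Lemma l2n_sum (I : Type) (r : seq I) (F : I -> nat -> A) :
  (forall k, l2 (F k)) -> l2n (\sum_(i <- r) F i) <= \sum_(i <- r) l2n (F i).
Proof.
move=> lF; elim: r => [|k r IH]; first by rewrite !big_nil l2n0.
rewrite !big_cons (le_trans (l2nD hA _ _)) ?lerD2l //; exact: l2_sum.
Qed.

End L2InnerProduct.

(** * Bounded operators and the tails of compact ones *)

Section BoundedOperators.
Variables (R : realType) (A : cstarAlgType R).
Hypothesis hA : wstar_algebra A.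
Implicit Types (x y z : nat -> A) (a : A) (F G K : (nat -> A) -> (nat -> A)).

Lemma B_l2_bound G : B_l2 G ->
  exists2 c : R, 0 <= c & forall x, l2 x -> l2n (G x) <= c * l2n x.
Proof.
move=> [_ _ _ [c Gc]]; apply: (@real_bound _ _ _ _ _ c) => [x _|x|x lx].
- exact: l2n_ge0.
- exact: l2n_ge0.
by rewrite -!l2_normE; exact: Gc.
Qed.

Lemma B_l2N G x : B_l2 G -> l2 x -> G (- x) = - G x.
Proof. by move=> [_ _ Ga _] lx; rewrite -!ractN1 Ga. Qed.

Lemma B_l2B G x y : B_l2 G -> l2 x -> l2 y -> G (x - y) = G x - G y.
Proof.
move=> hG lx ly; have [_ GD _ _] := hG.
by rewrite GD ?(B_l2N hG) //; exact: l2N.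
Qed.

Lemma B_l2_sum G (u : nat -> nat -> A) n : B_l2 G -> (forall k, l2 (u k)) ->
  G (\sum_(k < n) u k) = \sum_(k < n) G (u k).
Proof.
move=> hG lu; have [_ GD _ _] := hG; elim: n => [|n IH].
  by rewrite !big_ord0 -(subrr 0) (B_l2B hG) ?subrr //; exact: l20.
by rewrite !big_ord_recr /= GD ?IH //; exact: l2_sum.
Qed.

Lemma free_norm_coord n (s : 'I_n -> A) i :
  (rnorm (s i))%:C%C <= free_norm s.
Proof.
rewrite /free_norm /ip_norm rnormE sqrtC_real ?rnorm_ge0 // lecR.
apply: le_of_sqr; rewrite ?sqrtr_ge0 // sqr_sqrtr ?rnorm_ge0 // -rnorm_cstar.
have := gram_mask hA (index_enum 'I_n) (pred1 i) s.
rewrite -/(free_ip s s) {1}/gram (bigD1 i) //= eqxx big1 ?addr0 // => j /negbTE->.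
by rewrite mulr0.
Qed.

Lemma free_sumE n (s : 'I_n -> A) :
  s = \sum_(i < n) ract (fun j => if j == i then 1 else 0) (s i).
Proof.
apply/funext => j; rewrite fct_sumE (bigD1 j) //= /ract eqxx mul1r big1 ?addr0 // => i.
by rewrite eq_sym => /negbTE->; rewrite mul0r.
Qed.

Lemma finite_tails_small n (v : 'I_n -> nat -> A) (e : R) :
  (forall i, l2 (v i)) -> 0 < e -> exists k, forall m, (k <= m)%N -> forall i,
    l2n (tail m (v i)) < e.
Proof.
move=> lv e0; have /choice[k kP] i := tail_small hA (lv i) e0.
exists (\max_i k i)%N => m km i; apply: kP.
by rewrite (leq_trans _ km) // (leq_bigmax i).
Qed.

(** The estimate is in terms of the coefficients, since the norm of an element of a span does not by
    itself bound the coefficients used to write it. *)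
Lemma span_tail_le n (v : 'I_n -> nat -> A) (a : 'I_n -> A) (e c : R) m :
  (forall i, l2 (v i)) -> 0 <= c ->
  (forall i, l2n (tail m (v i)) <= e) -> (forall i, rnorm (a i) <= c) ->
  l2n (tail m (\sum_i ract (v i) (a i))) <= n%:R * (e * c).
Proof.
move=> lv c0 ve ac; rewrite tail_sum (le_trans (l2n_sum hA _ _)) // => [i|].
  by rewrite tail_ract; apply/(l2_ract hA)/(l2_tail hA).
rewrite (le_trans (y := \sum_(i < n) e * c)) //.
  apply: ler_sum => i _; rewrite tail_ract.
  have lt : l2 (tail m (v i)) by exact: l2_tail.
  by rewrite (le_trans (l2n_ract hA _ lt)) // ler_pM ?l2n_ge0 ?rnorm_ge0.
by rewrite sumr_const card_ord mulr_natl.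
Qed.

(** F x is the combination of the fixed vectors T(e_i) with coefficients (S x)_i, which are bounded
    by a multiple of |x|; only finitely many tails have to be small. *)
Lemma factors_free_tail F (e : R) : factors_free F -> 0 < e ->
  exists k, forall m, (k <= m)%N -> forall x, l2 x -> l2n (tail m (F x)) <= e * l2n x.
Proof.
move=> [n [S [T [[_ _ _ [c Sc]] [T2 TD Ta _] FE]]]] e0.
have [c' c'0 Sc'] : exists2 c' : R, 0 <= c' & forall x, l2 x ->
    (forall i, rnorm (S x i) <= c' * l2n x).
  have [|||c' c'0 h] := @real_bound _ _ (@l2 R A) (fun x => Num.sqrt (rnorm (free_ip (S x) (S x))))
    (@l2n R A) c.
  - by move=> x _; exact: sqrtr_ge0.
  - by move=> x; exact: l2n_ge0.
  - move=> x lx; rewrite -sqrtC_real ?rnorm_ge0 // -rnormE -l2_normE.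
    exact: Sc.
  exists c' => // x lx i; rewrite (le_trans _ (h x lx)) //.
  have := free_norm_coord (S x) i.
  by rewrite /free_norm /ip_norm rnormE sqrtC_real ?rnorm_ge0 // lecR.
pose u i := T (fun j => if j == i then 1 else 0).
have lu i : l2 (u i) by exact: T2.
have TE s : T s = \sum_i ract (u i) (s i).
  have T0 : T 0 = 0.
    have -> : (0 : 'I_n -> A) = ract 0 0 by apply/funext => j; rewrite /ract mulr0.
    by rewrite Ta //; apply/funext => j; rewrite /ract mulr0.
  rewrite {1}(free_sumE s) (big_morph T (fun s t => TD s t I I) T0).
  by apply: eq_bigr => i _; rewrite Ta.
(* The added 1 keeps the divisor positive when [n] or [c'] is zero. *)
have d0 : 0 < n%:R * c' + 1 by rewrite ltr_wpDl ?mulr_ge0.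
have [k kP] := finite_tails_small lu (divr_gt0 e0 d0).
exists k => m km x lx; rewrite FE // TE.
have cx0 : 0 <= c' * l2n x by rewrite mulr_ge0 ?l2n_ge0.
rewrite (le_trans (span_tail_le lu cx0 (fun i => ltW (kP m km i)) (Sc' x lx))) //.
set d := n%:R * c' + 1 in d0 *.
have -> : n%:R * (e / d * (c' * l2n x)) = n%:R * c' / d * (e * l2n x) by ring.
rewrite ler_piMl ?mulr_ge0 ?l2n_ge0 ?(ltW e0) // ler_pdivrMr // mul1r.
by rewrite lerDl.
Qed.

Lemma compact_tail K (e : R) : K_l2 K -> 0 < e ->
  exists k, forall m, (k <= m)%N -> forall x, l2 x -> l2n (tail m (K x)) <= e * l2n x.
Proof.
move=> [[K2 _ _ _] hK] e0; have e2 : 0 < e / 2 by rewrite divr_gt0.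
have [|F [fF KF]] := hK (e / 2)%:C%C; first by rewrite ltcR.
have [k kP] := factors_free_tail fF e2; exists k => m km x lx.
have lF : l2 (F x).
  by have [n [S [T [[S2 _ _ _] [T2 _ _ _] ->]]]] := fF; last exact: lx; apply: T2.
have lKF := l2B hA (K2 _ lx) lF.
have -> : tail m (K x) = tail m (K x - F x) + tail m (F x).
  by rewrite -tailD subrK.
rewrite (le_trans (l2nD hA (l2_tail hA lKF) (l2_tail hA lF))) //.
have := KF x lx; rewrite !l2_normE -rmorphM lecR => KFx.
have := l2n_tail hA m lKF; have := kP m km x lx.
move: KFx; move: (l2n _) (l2n _) (l2n _) (l2n _) => p q r s; move=> *; lra.
Qed.

End BoundedOperators.

(** * Open mapping theorem for G on M' together with finitely many generators *)

Section OpenMapping.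
Variables (R : realType) (A : cstarAlgType R).
Hypothesis hA : wstar_algebra A.
Variables (G : (nat -> A) -> (nat -> A)) (M' : set (nat -> A)).
Variables (n : nat) (v : 'I_n -> nat -> A).
Hypotheses (hG : B_l2 G) (hM' : closed_submodule M') (lv : forall i, l2 (v i)).
Implicit Types (x y z w : nat -> A) (a b : 'I_n -> A).

Definition comb a : nat -> A := \sum_i ract (v i) (a i).

Lemma l2_comb a : l2 (comb a).
Proof. by apply: l2_sum => // i; exact: l2_ract. Qed.

Lemma comb_sub a b : comb (fun i => a i - b i) = comb a - comb b.
Proof.
rewrite /comb -sumrB; apply: eq_bigr => i _.
by apply/funext => j; exact: mulrBr.
Qed.

Lemma comb_scale (t : R) a : comb (fun i => t%:C%C *: a i) = t%:C%C *: comb a.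
Proof.
rewrite /comb scaler_sumr; apply: eq_bigr => i _.
by apply/funext => j; rewrite /ract scaler_mulr.
Qed.

Lemma l2n_comb_le a (d : R) : (forall i, rnorm (a i) <= d) ->
  l2n (comb a) <= (\sum_i l2n (v i)) * d.
Proof.
move=> ad; rewrite (le_trans (l2n_sum hA _ _)) // => [i|]; first exact: l2_ract.
rewrite mulr_suml; apply: ler_sum => i _.
by rewrite (le_trans (l2n_ract hA _ (@lv i))) // ler_wpM2l ?l2n_ge0.
Qed.

(** The gauge to which [gauge_bounded] is applied. It bounds the coefficients as well as [w], which
    is what [span_tail_le] consumes. *)
Definition solvable x (r : R) : Prop := exists w a,
  [/\ M' w, l2n w <= r, forall i, rnorm (a i) <= r & x = G w + comb a].

Lemma solvable_series (y : nat -> nat -> A) (c : R) x : l2 x -> (forall k, l2 (y k)) ->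
  (forall k, solvable (y k) (c * 2^-1 ^+ k)) ->
  (forall e, 0 < e -> exists k, forall m, (k <= m)%N ->
     l2n (x - \sum_(k < m) y k) < e) ->
  solvable x (2 * c).
Proof.
move=> lx ly hy xy; have [MS _ _ _ _] := hM'.
have [G2 _ _ _] := hG; have [g g0 Gg] := B_l2_bound hG.
have /choice[W WP] k : exists wa : (nat -> A) * ('I_n -> A),
    [/\ M' wa.1, l2n wa.1 <= c * 2^-1 ^+ k,
        forall i, rnorm (wa.2 i) <= c * 2^-1 ^+ k & y k = G wa.1 + comb wa.2].
  by have [w [a h]] := hy k; exists (w, a).
have MW k : M' (W k).1 by have [] := WP k.
have [||w [Mw wc wP]] := @geometric_series _ _ _ _
  (closed_submodule_complete hA hM') (fun k => (W k).1) c.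
- exact: MW.
- by move=> k; have [] := WP k.
have /choice[a aP] i : exists b : A, rnorm b <= 2 * c /\
    forall e, 0 < e -> exists k, forall m, (k <= m)%N ->
      rnorm (b - \sum_(k < m) (W k).2 i) < e.
  have [//||b [_ bc bP]] := @geometric_series _ _ _ _
    (algebra_complete A) (fun k => (W k).2 i) c; last by exists b.
  by move=> k; have [_ _ + _] := WP k; exact.
have lw := MS _ Mw; have lW k := MS _ (MW k).
exists w, a; split=> //; first by move=> i; exact: (aP i).1.
have cl2 := closed_submodule_complete hA (l2_closed_submodule hA).
have lGw := G2 _ lw; have lc : l2 (comb a) by exact: l2_comb.
apply: (cn_eq cl2) => //; first exact: l2D.
move=> e e0; pose V := \sum_i l2n (v i).
have V0 : 0 <= V by apply: sumr_ge0 => i _; exact: l2n_ge0.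
have d0 : 0 < 1 + g + V by rewrite -addrA ltr_wpDr ?addr_ge0.
(* The error has three parts: the remainder of the series (weight 1), G of the error on w (weight
   g), and the combination of the coefficient errors (weight V). *)
pose d := e / (1 + g + V); have dp : 0 < d by rewrite divr_gt0.
have [k1 h1] := xy d dp; have [k2 h2] := wP d dp.
have /choice[k3 h3] i := (aP i).2 d dp.
pose m := maxn k1 (maxn k2 (\max_i k3 i)%N).
have {}h1 := h1 m (leq_maxl _ _).
have {}h2 : l2n (w - \sum_(k < m) (W k).1) < d.
  by apply: h2; rewrite leq_max leq_max leqnn orbT.
have {}h3 i : rnorm (a i - \sum_(k < m) (W k).2 i) < d.
  by apply: h3; rewrite leq_max leq_max (leq_bigmax i) !orbT.
pose s := \sum_(k < m) (W k).1; pose b i := \sum_(k < m) (W k).2 i.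
have ls : l2 s by exact: l2_sum.
have sumE : \sum_(k < m) y k = G s + comb b.
  rewrite /s (@B_l2_sum _ _ hA G (fun k => (W k).1)) // /comb /b.
  have -> : \sum_i ract (v i) (\sum_(k < m) (W k).2 i) = \sum_(k < m) comb (W k).2.
    rewrite exchange_big; apply: eq_bigr => i _.
    apply: (big_morph (ract (v i))) => [p q|]; first exact: ractDr.
    by apply/funext => j; rewrite /ract mulr0.
  by rewrite -big_split; apply: eq_bigr => k _; have [] := WP k.
have -> : x - (G w + comb a) =
    (x - \sum_(k < m) y k) - (G (w - s) + comb (fun i => a i - b i)).
  rewrite (B_l2B hA hG) // comb_sub sumE addrACA -opprD opprB [RHS]addrA.
  by rewrite subrK.
have lws : l2 (w - s) by exact: l2B.
have lsum : l2 (x - \sum_(k < m) y k) by apply: l2B => //; exact: l2_sum.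
have lr : l2 (G (w - s) + comb (fun i => a i - b i)).
  by apply: l2D => //; [exact: G2 | exact: l2_comb].
rewrite (le_trans (l2nB hA lsum lr)) //.
have hs := l2nD hA (G2 _ lws) (l2_comb (a := fun i => a i - b i)).
have hg : l2n (G (w - s)) <= g * d.
  by rewrite (le_trans (Gg _ lws)) // ler_wpM2l // ltW.
have hV : l2n (comb (fun i => a i - b i)) <= V * d.
  by apply: l2n_comb_le => i; rewrite ltW // h3.
have -> : e = d * (1 + g + V) by rewrite /d divfK // gt_eqF.
have aux (p q r t : R) : p < d -> q <= r + t -> r <= g * d -> t <= V * d ->
  p + q <= d * (1 + g + V) by move=> *; lra.
exact: aux h1 hs hg hV.
Qed.

Lemma open_mapping :
  (forall x, l2 x -> exists w a, M' w /\ x = G w + comb a) ->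
  exists2 C : R, 0 <= C & forall x, l2 x -> solvable x (C * l2n x).
Proof.
move=> hsol; have [MS M0 MD MZ _] := hM'; have [_ _ Ga _] := hG.
apply: (gauge_bounded (closed_submodule_complete hA (l2_closed_submodule hA))).
- move=> x /hsol[w [a [Mw xE]]]; exists (l2n w + \sum_i rnorm (a i)), w, a.
  have a0 : 0 <= \sum_i rnorm (a i) by apply: sumr_ge0 => i _; exact: rnorm_ge0.
  split=> // [|i]; first by rewrite lerDl.
  rewrite (bigD1 i) //= addrCA lerDl addr_ge0 ?l2n_ge0 ?sumr_ge0 // => j _.
  exact: rnorm_ge0.
- move=> x r s [w [a [Mw wr ar xE]]] rs; exists w, a; split=> // [|i];
    exact: le_trans rs.
- move=> x y r s [w [a [Mw wr ar ->]]] [w' [a' [Mw' wr' ar' ->]]].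
  have lw := MS _ Mw; have lw' := MS _ Mw'.
  exists (w - w'), (fun i => a i - a' i); split.
  + by apply: MD => //; rewrite -ractN1; exact: MZ.
  + by rewrite (le_trans (l2nB hA lw lw')) // lerD.
  + by move=> i; rewrite (le_trans (rnormB _ _)) // lerD.
  + by rewrite (B_l2B hA hG) // comb_sub opprD addrACA.
- move=> x r t [w [a [Mw wr ar ->]]] t0; have lw := MS _ Mw.
  exists (t%:C%C *: w), (fun i => t%:C%C *: a i); split.
  + by rewrite realZ_ract; exact: MZ.
  + by rewrite (l2n_scale hA _ lw) ger0_norm // ler_wpM2l.
  + by move=> i; rewrite rnormZ ger0_norm // ler_wpM2l.
  + by rewrite comb_scale [t%:C%C *: w]realZ_ract Ga // -realZ_ract -scalerDr.
- exact: solvable_series.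
Qed.

End OpenMapping.

(** * A bounded A-linear lift modulo N *)

Section Perturbation.
Variables (R : realType) (A : cstarAlgType R).
Hypothesis hA : wstar_algebra A.
Implicit Types (x y z w : nat -> A) (a : A) (G K : (nat -> A) -> (nat -> A)).

Lemma fin_span_gen n (v : 'I_n -> nat -> A) i : fin_span v (v i).
Proof.
exists (fun=> 0), (fun j => if j == i then 1 else 0).
rewrite (bigD1 i) //= eqxx scale0r add0r big1 ?addr0 => [|j /negbTE->].
  by apply/funext => k; rewrite /ract mulr1.
by rewrite scale0r add0r; apply/funext => k; rewrite /ract mulr0.
Qed.

Lemma scale_add_ract x (c : R[i]) a : c *: x + ract x a = ract x (c *: (1 : A) + a).
Proof.
by apply/funext => i; rewrite /ract mulrDr scaler_mulr mulr1.
Qed.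

Lemma ractBl x y a : ract (x - y) a = ract x a - ract y a.
Proof. by apply/funext => i; exact: mulrBl. Qed.

Lemma fin_span_comb n (v : 'I_n -> nat -> A) x : fin_span v x <-> exists b, x = comb v b.
Proof.
split=> [[c [a ->]]|[a ->]].
  exists (fun i => c i *: (1 : A) + a i).
  by apply: eq_bigr => i _; rewrite scale_add_ract.
by exists (fun=> 0), a; apply: eq_bigr => i _; rewrite scale0r add0r.
Qed.

Lemma B_l2_add G K : B_l2 G -> B_l2 K -> B_l2 (G \+ K).
Proof.
move=> hG hK; have [c _ Gc] := B_l2_bound hG; have [d _ Kd] := B_l2_bound hK.
have [G2 GD Ga _] := hG; have [K2 KD Ka _] := hK; split=> [x lx|x y lx ly|x a lx|].
- by apply: l2D => //; [exact: G2 | exact: K2].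
- by rewrite /= GD // KD // addrACA.
- by rewrite /= Ga // Ka // ractDl.
exists (c + d)%:C%C => x lx; rewrite !l2_normE -rmorphM lecR mulrDl.
have h := l2nD hA (G2 _ lx) (K2 _ lx).
by apply: (le_trans h); apply: lerD; [exact: Gc | exact: Kd].
Qed.

(* [lift] solves [x = G (lift x)] modulo the finitely generated summand. *)
Lemma MPhi_lift G : MPhi_minus_hat G ->
  exists n (v : 'I_n -> nat -> A) (lift : (nat -> A) -> (nat -> A)) (C : R),
  [/\ forall i, l2 (v i), 0 <= C,
      forall x y, l2 x -> l2 y -> lift (x + y) = lift x + lift y,
      forall x a, l2 x -> lift (ract x a) = ract (lift x) a
    & forall x, l2 x -> [/\ l2 (lift x), l2n (lift x) <= C * l2n x
        & exists2 b, forall i, rnorm (b i) <= C * l2n x & x - G (lift x) = comb v b]].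
Proof.
move=> [hG [M [N [M' [[cM cN cM'] [[dir int] [n [v NE]] [Gfun Ginj Gsurj]]]]]]].
have [Ml2 M0 MD MZ _] := cM; have [Nl2 N0 ND NZ _] := cN.
have [M'l2 _ M'D M'Z _] := cM'; have [_ GD Ga _] := hG.
have lv i : l2 (v i) by apply: Nl2; rewrite NE; exact: fin_span_gen.
have sub S x y : (forall x y, S x -> S y -> S (x + y)) ->
    (forall x a, S x -> S (ract x a)) -> S x -> S y -> S (x - y).
  by move=> SD SZ Sx Sy; apply: SD => //; rewrite -ractN1; exact: SZ.
have [x lx|C C0 hC] := open_mapping hA hG cM' lv.
  have [p Mp [q Nq ->]] := (dir x).1 lx.
  have [w M'w <-] := Gsurj _ Mp; exists w.
  by move: Nq; rewrite NE => /fin_span_comb[b ->]; exists b.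
have /choice[lift liftP] x : exists w, l2 x -> [/\ M' w, N (x - G w), l2n w <= C * l2n x
    & exists2 b, forall i, rnorm (b i) <= C * l2n x & x - G w = comb v b].
  have [lx|?] := pselect (l2 x); last by exists 0.
  have [w [b [Mw wC bC xE]]] := hC x lx; exists w => _.
  have e : x - G w = comb v b by rewrite xE addrAC subrr add0r.
  split=> //; last by exists b.
  by rewrite e NE; apply/fin_span_comb; exists b.
(* [lift] comes from a choice of bounded solutions; M and N meeting in 0 and injectivity of G on M'
   determine it uniquely, which yields additivity and A-linearity. *)
have uniq x w : l2 x -> M' w -> N (x - G w) -> lift x = w.
  move=> lx Mw Nw; have [Ml Nl _ _] := liftP x lx.
  apply: Ginj; rewrite ?in_setE //; apply/eqP; rewrite -subr_eq0; apply/eqP.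
  suff : (M `&` N) (G (lift x) - G w) by rewrite int.
  split; first by apply: sub => //; exact: Gfun.
  have -> : G (lift x) - G w = (x - G w) - (x - G (lift x)).
    by rewrite opprB [RHS]addrC [RHS]addrA subrK.
  exact: sub.
exists n, v, lift, C; split=> // [x y lx ly|x a lx|x lx]; last first.
- by have [Mw _ wC hb] := liftP x lx; split=> //; exact: M'l2.
- have [Mw Nw _ _] := liftP x lx; apply: uniq; [exact: l2_ract | exact: M'Z |].
  by have := NZ _ a Nw; rewrite ractBl Ga //; exact: M'l2.
have [Mx Nx _ _] := liftP x lx; have [My Ny _ _] := liftP y ly.
apply: uniq; [exact: l2D | exact: M'D |].
by have := ND _ _ Nx Ny; rewrite addrACA -opprD -GD //; exact: M'l2.
Qed.

End Perturbation.

(** * Invertibility on tails and the graph in the range *)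

Section TailGraph.
Variables (R : realType) (A : cstarAlgType R).
Hypothesis hA : wstar_algebra A.
Implicit Types (x y z w : nat -> A) (a : A) (G K : (nat -> A) -> (nat -> A)).

(** On [tails m] the defect of q_m D lift from the identity is q_m (y - G (lift y)) - q_m K (lift
    y): a tail of a bounded combination of generators minus a tail of a compact image. Both are
    small, and [sol] is [lift] after the Neumann inverse. *)
Lemma tail_invertible G K : MPhi_minus_hat G -> K_l2 K ->
  exists m (sol : (nat -> A) -> (nat -> A)) (C : R),
  [/\ 0 <= C, forall x y, tails m x -> tails m y -> sol (x + y) = sol x + sol y,
      forall x a, tails m x -> sol (ract x a) = ract (sol x) a
    & forall x, tails m x -> [/\ l2 (sol x), l2n (sol x) <= C * l2n x
        & tail m ((G \+ K) (sol x)) = x]].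
Proof.
move=> hG hK; have [n [v [lift [C [lv C0 liftD liftZ liftP]]]]] := MPhi_lift hA hG.
have hD : B_l2 (G \+ K) by apply: B_l2_add => //; [exact: hG.1 | exact: hK.1].
have [D2 DD Da _] := hD; have [G2 _ _ _] := hG.1; have [K2 _ _ _] := hK.1.
(* The generators contribute n C e and the compact part C e, in total at most 1/4; the 1 keeps the
   divisor positive. *)
pose e := (4 * (n%:R * C + C + 1))^-1.
have d0 : 0 < n%:R * C + C + 1 by rewrite ltr_wpDl // addr_ge0 // mulr_ge0.
have e0 : 0 < e by rewrite invr_gt0 mulr_gt0.
have [k1 h1] := finite_tails_small hA lv e0.
have [k2 h2] := compact_tail hA hK e0.
pose m := maxn k1 k2; have {}h1 := h1 m (leq_maxl _ _); have {}h2 := h2 m (leq_maxr _ _).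
pose E y := y - tail m ((G \+ K) (lift y)).
have cT := tails_closed hA m; have [Tl2 T0 TD TZ _] := cT.
have cn := closed_submodule_complete hA cT.
have Tt x : l2 x -> tails m (tail m x) by move=> lx; split; [exact: l2_tail | exact: tail_idem].
have l2l x : l2 x -> l2 (lift x) by case/liftP.
have ET y : tails m y -> tails m (E y).
  by move=> Ty; apply: (cn_sub cn) => //; apply/Tt/D2/l2l/Tl2.
have liftB x y : l2 x -> l2 y -> lift (x - y) = lift x - lift y.
  move=> lx ly; have ly' : l2 (ract y (-1)) by exact: l2_ract.
  by rewrite -(ractN1 y) (liftD _ _ lx ly') (liftZ _ _ ly) ractN1.
have EB y z : tails m y -> tails m z -> E (y - z) = E y - E z.
  move=> /Tl2 ly /Tl2 lz; rewrite /E liftB // (B_l2B hA hD) ?tailB; try exact: l2l.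
  by rewrite !opprB [LHS]addrACA [RHS]addrACA (addrC (- z)).
have EN y : tails m y -> l2n (E y) <= 2^-1 * l2n y.
  move=> [ly ty]; have [ll lC [b bC yE]] := liftP y ly.
  have -> : E y = tail m (y - G (lift y)) - tail m (K (lift y)).
    by rewrite -tailB -addrA -opprD tailB ty.
  have lyG : l2 (y - G (lift y)) by apply: l2B => //; exact: G2.
  rewrite (le_trans (l2nB hA (l2_tail hA lyG) (l2_tail hA (K2 _ ll)))) //.
  have Cy0 : 0 <= C * l2n y by rewrite mulr_ge0 ?l2n_ge0.
  have i1 := span_tail_le hA lv Cy0 (fun i => ltW (h1 i)) bC.
  rewrite -/(comb v b) -yE in i1.
  have i2 : l2n (tail m (K (lift y))) <= e * (C * l2n y).
    by rewrite (le_trans (h2 _ ll)) // ler_wpM2l // ltW.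
  have i3 : n%:R * (e * (C * l2n y)) + e * (C * l2n y) <= 2^-1 * l2n y.
    have -> : n%:R * (e * (C * l2n y)) + e * (C * l2n y) = (n%:R * C + C) * e * l2n y by ring.
    rewrite ler_wpM2r ?l2n_ge0 // /e ler_pdivrMr ?mulr_gt0 //.
    have : 0 <= n%:R * C + C by rewrite addr_ge0 ?mulr_ge0.
    by move=> *; lra.
  exact: le_trans (lerD i1 i2) i3.
have /choice[Y YP] x : exists y, tails m x -> tails m y /\ tail m ((G \+ K) (lift y)) = x.
  have [Tx|?] := pselect (tails m x); last by exists 0.
  have [y Ty yE] := neumann_series cn ET EB EN Tx.
  by exists y => _; split=> //; rewrite -yE /E opprB addrC subrK.
(* The difference z of two solutions satisfies E z = z, while |E z| <= |z| / 2. As for [lift],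
   uniqueness yields linearity. *)
have Yuniq x y : tails m x -> tails m y -> tail m ((G \+ K) (lift y)) = x -> Y x = y.
  move=> Tx Ty yE; have [TY YE] := YP x Tx.
  have Tz := cn_sub cn TY Ty; apply/eqP; rewrite -subr_eq0; apply/eqP.
  apply: (l2n_eq0 hA (Tl2 _ Tz)); apply/le_anti; rewrite l2n_ge0 andbT.
  have := EN _ Tz; rewrite EB // /E YE yE opprB addrA subrK.
  by move=> *; lra.
(* From |Y x - x| <= |Y x| / 2 follows |Y x| <= 2 |x|. *)
exists m, (lift \o Y), (C * 2); split; first by rewrite mulr_ge0.
- move=> x y Tx Ty; have [Tx' xE] := YP x Tx; have [Ty' yE] := YP y Ty.
  have lx := Tl2 _ Tx'; have ly := Tl2 _ Ty'.
  have E1 : tail m ((G \+ K) (lift (Y x + Y y))) = x + y.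
    by rewrite (liftD _ _ lx ly) (DD _ _ (l2l _ lx) (l2l _ ly)) tailD xE yE.
  by rewrite /= (Yuniq _ _ (TD _ _ Tx Ty) (TD _ _ Tx' Ty') E1) (liftD _ _ lx ly).
- move=> x a Tx; have [Tx' xE] := YP x Tx; have lx := Tl2 _ Tx'.
  have E1 : tail m ((G \+ K) (lift (ract (Y x) a))) = ract x a.
    by rewrite (liftZ _ _ lx) (Da _ _ (l2l _ lx)) tail_ract xE.
  by rewrite /= (Yuniq _ _ (TZ _ _ Tx) (TZ _ _ Tx') E1) (liftZ _ _ lx).
move=> x Tx; have [Ty xE] := YP x Tx; have [ll lC _] := liftP _ (Tl2 _ Ty).
split=> //; rewrite (le_trans lC) // -mulrA ler_wpM2l //.
have := EN _ Ty; rewrite /E xE => hle.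
have := l2nD hA (Tl2 _ (cn_sub cn Ty Tx)) (Tl2 _ Tx); rewrite subrK => *; lra.
Qed.

(** Theta x is what D (sol (q_m x)) has in the first m coordinates. Precomposing with q_m defines it
    on all of l_2(A) and makes it vanish on A^m. *)
Lemma range_contains_graph G K : MPhi_minus_hat G -> K_l2 K ->
  exists m (Theta : (nat -> A) -> (nat -> A)),
  [/\ B_l2 Theta, forall x, l2 x -> tail m (Theta x) = 0,
      forall x, l2 x -> tail m x = 0 -> Theta x = 0
    & forall x, l2 x -> exists2 w, l2 w & (G \+ K) w = tail m x + Theta x].
Proof.
move=> hG hK; have [m [sol [C [C0 solD solZ solP]]]] := tail_invertible hG hK.
have hD : B_l2 (G \+ K) by apply: B_l2_add => //; [exact: hG.1 | exact: hK.1].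
have [D2 DD Da _] := hD; have [d d0 Dd] := B_l2_bound hD.
have Tt x : l2 x -> tails m (tail m x) by move=> lx; split; [exact: l2_tail | exact: tail_idem].
pose Theta x := (G \+ K) (sol (tail m x)) - tail m x.
have ls x : l2 x -> l2 (sol (tail m x)) by move=> /Tt/solP[].
have hT : B_l2 Theta.
  split=> [x lx|x y lx ly|x a lx|].
  - by apply: l2B => //; [apply/D2/ls | exact: l2_tail].
  - rewrite /Theta tailD (solD _ _ (Tt _ lx) (Tt _ ly)) (DD _ _ (ls _ lx) (ls _ ly)).
    by rewrite opprD; exact: addrACA.
  - rewrite /Theta tail_ract (solZ _ _ (Tt _ lx)) (Da _ _ (ls _ lx)).
    by apply/esym; exact: ractBl.
  exists (d * C + 1)%:C%C => x lx; rewrite !l2_normE -rmorphM lecR.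
  have lt := l2_tail hA (m := m) lx.
  have h := l2nB hA (D2 _ (ls _ lx)) lt; rewrite -/(Theta x) in h.
  rewrite mulrDl mul1r; apply: (le_trans h); apply: lerD; last exact: l2n_tail.
  have [_ sC _] := solP _ (Tt _ lx).
  apply: (le_trans (Dd _ (ls _ lx))); rewrite -mulrA; apply: ler_wpM2l => //.
  by apply: (le_trans sC); apply: ler_wpM2l => //; exact: l2n_tail.
have tT x : l2 x -> tail m (Theta x) = 0.
  move=> lx; rewrite /Theta tailB tail_idem.
  by have [_ _ ->] := solP _ (Tt _ lx); rewrite subrr.
exists m, Theta; split=> // [x lx x0|x lx].
  have l0 := l20 hA; have T0 : Theta 0 = 0.
    by have := B_l2B hA hT l0 l0; rewrite !subrr.
  by have -> : Theta x = Theta 0 by rewrite /Theta x0 tail0.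
exists (sol (tail m x)); first exact: ls.
by rewrite /Theta addrC subrK.
Qed.

End TailGraph.

(** * The sheared inner product and its complements *)

Section NewInnerProduct.
Variables (R : realType) (A : cstarAlgType R).
Hypothesis hA : wstar_algebra A.
Variables (m : nat) (Theta : (nat -> A) -> (nat -> A)).
Hypotheses (hT : B_l2 Theta) (tT : forall x, l2 x -> tail m (Theta x) = 0)
  (T0 : forall x, l2 x -> tail m x = 0 -> Theta x = 0).
Implicit Types (x y z : nat -> A).

(* The inverse of the shear [x |-> x + Theta x]. *)
Definition shear_inv x := x - Theta x.
Definition shear_ip x y : A := l2_ip (shear_inv x) (shear_inv y).

Let lT x : l2 x -> l2 (Theta x). Proof. by have [h _ _ _] := hT; exact: h. Qed.

Lemma l2_shear_inv x : l2 x -> l2 (shear_inv x).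
Proof. by move=> lx; apply: l2B => //; exact: lT. Qed.

(** Theta takes its values in A^m and vanishes there, so its square is 0 and 1 - Theta inverts 1 +
    Theta. *)
Lemma shear_invK x : l2 x -> shear_inv x + Theta (shear_inv x) = x.
Proof.
move=> lx; have lt := lT lx.
by rewrite {2}/shear_inv (B_l2B hA hT) // (T0 lt (tT lx)) subr0 subrK.
Qed.

Lemma shear_inv_shear x : l2 x -> shear_inv (x + Theta x) = x.
Proof.
move=> lx; have lt := lT lx; have [_ TD _ _] := hT.
by rewrite /shear_inv TD // (T0 lt (tT lx)) addr0 addrK.
Qed.

Lemma shear_inv_bound : exists2 c : R, 0 <= c &
  forall x, l2 x -> l2n (shear_inv x) <= c * l2n x /\ l2n x <= c * l2n (shear_inv x).
Proof.
have [c c0 Tc] := B_l2_bound hT; exists (1 + c) => [|x lx]; first exact: addr_ge0.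
have li := l2_shear_inv lx; split; rewrite mulrDl mul1r.
  by apply: (le_trans (l2nB hA lx (lT lx))); rewrite lerD2l Tc.
have := l2nD hA li (lT li); rewrite shear_invK // => h.
by apply: (le_trans h); rewrite lerD2l Tc.
Qed.

Lemma shear_ip_inner_product : l2_inner_product shear_ip.
Proof.
have [_ TD Ta _] := hT; split=> [x y z lx ly lz|x y a lx ly|x y lx ly|x lx|x lx].
- have -> : shear_ip x (y + z) = l2_ip (shear_inv x) (shear_inv y + shear_inv z).
    by rewrite /shear_ip /shear_inv TD // opprD addrACA.
  by apply: l2_ipDr => //; exact: l2_shear_inv.
- have -> : shear_ip x (ract y a) = l2_ip (shear_inv x) (ract (shear_inv y) a).
    by rewrite /shear_ip /shear_inv Ta // ractBl.
  by apply: l2_ip_ract => //; exact: l2_shear_inv.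
- by apply: l2_ip_star => //; exact: l2_shear_inv.
- by apply: l2_ip_nneg => //; exact: l2_shear_inv.
move=> ip0; have li := l2_shear_inv lx.
have i0 : shear_inv x = 0.
  by apply: (l2n_eq0 hA li); rewrite /l2n -/(shear_ip x x) ip0 rnorm0 sqrtr0.
by rewrite -(shear_invK lx) i0 (T0 (l20 hA) (tail0 A m)) addr0.
Qed.

Lemma shear_ip_equivalent : equivalent_ip shear_ip (@l2_ip R A).
Proof.
have [c c0 hc] := shear_inv_bound; exists c%:C%C, c%:C%C => x lx.
have [h1 h2] := hc x lx.
have -> : ip_norm shear_ip x = (l2n (shear_inv x))%:C%C by rewrite -l2_normE.
rewrite -[ip_norm _ x]/(l2_norm x) l2_normE -!rmorphM.
by split; rewrite lecR.
Qed.

Lemma finsupp_tail x : (forall i, (m <= i)%N -> x i = 0) <-> tail m x = 0.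
Proof.
split=> [x0|tx i mi]; first by apply/funext => i; rewrite /tail; case: leqP => // /x0.
by have := congr1 (fun f : nat -> A => f i) tx; rewrite /tail mi.
Qed.

(** Orthogonality to the graph forces [shear_inv y] into A^m, where the shear is the identity, so y
    itself lies in A^m. The other elements of S only impose linear equations there, and the
    solutions are generated by the columns of P. *)
Lemma shear_complement_fg (S : set (nat -> A)) : S `<=` l2 (A := A) ->
  (forall x, l2 x -> tail m x = x -> S (x + Theta x)) ->
  finitely_generated (orthogonal_complement shear_ip S).
Proof.
move=> Sl2 ST.
(* A vector of A^m is fixed by [shear_inv], hence pairs with z only through the first m coordinates
   of [shear_inv z]. *)
have [P [Pann Pgen]] := @annihilator_generated _ _ m
  [set u | exists2 z, S z & u = fun i : 'I_m => shear_inv z i] hA.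
pose v (j : 'I_m) (i : nat) : A := if insub i is Some i' then P i' j else 0.
have vE j (i : 'I_m) : v j i = P i j by rewrite /v valK.
have v0 j i : (m <= i)%N -> v j i = 0 by move=> mi; rewrite /v insubF // ltnNge mi.
have ipE z y : S z -> (forall i, (m <= i)%N -> y i = 0) ->
    shear_ip z y = \sum_(i < m) star (shear_inv z i) * y i.
  move=> Sz y0; have ly := l2_finsupp hA y0.
  rewrite /shear_ip {2}/shear_inv (T0 ly) ?subr0; last exact/finsupp_tail.
  by rewrite (l2_ip_finsupp hA (l2_shear_inv (Sl2 _ Sz)) y0) /gram big_mkord.
exists m, v; apply/seteqP; split=> y.
  move=> [ly yS].
  pose y' := shear_inv y; have ly' : l2 y' by exact: l2_shear_inv.
  have y'0 i : (m <= i)%N -> y' i = 0.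
    (* The i-th standard vector with i >= m: its graph point lies in S and is sent back to [d] by
       [shear_inv], so the pairing reads off coordinate i of [y']. *)
    move=> mi; pose d k : A := if k == i then 1 else 0.
    have d0 k : (i.+1 <= k)%N -> d k = 0 by rewrite /d; case: eqP => // ->; rewrite ltnn.
    have ld : l2 d := l2_finsupp hA d0.
    have td : tail m d = d.
      by apply/funext => k; rewrite /tail /d; case: eqP => [->|_]; rewrite ?mi // if_same.
    have := yS _ (ST d ld td); rewrite /shear_ip shear_inv_shear // -/y'.
    move/(congr1 (@star R A)); rewrite (l2_ip_star hA ld ly').
    rewrite (l2_ip_finsupp hA ly' d0) /gram big_nat_recr //= big_nat big1 ?add0r.
      by rewrite /d eqxx mulr1 star0 => /(congr1 (@star R A)); rewrite starK star0.
    by move=> k /andP[_ ki]; rewrite /d ltn_eqF // mulr0.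
  have yE : y = y'.
    by rewrite -{1}(shear_invK ly) -/y' (T0 ly') ?addr0 //; exact/finsupp_tail.
  have y0 i : (m <= i)%N -> y i = 0 by rewrite yE; exact: y'0.
  apply/fin_span_comb; exists (fun j => y j).
  have gen := Pgen (fun i : 'I_m => y i).
  apply/funext => i; rewrite /comb fct_sumE.
  have [im|mi] := ltnP i m.
    rewrite (gen _ (Ordinal im)) => [|_ [z Sz ->]]; last by rewrite -ipE // yS.
    by apply: eq_bigr => j _; rewrite -vE.
  by rewrite y0 // big1 // => j _; rewrite /ract v0 // mul0r.
move=> /fin_span_comb[b ->].
have c0 i : (m <= i)%N -> comb v b i = 0.
  by move=> mi; rewrite /comb fct_sumE big1 // => j _; rewrite /ract v0 // mul0r.
split; first exact: l2_finsupp c0.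
move=> z Sz; rewrite ipE //.
under eq_bigr do rewrite /comb fct_sumE mulr_sumr.
rewrite exchange_big big1 //= => j _.
under eq_bigr do rewrite /ract vE mulrA.
by rewrite -mulr_suml (Pann (fun i => shear_inv z i)) ?mul0r //; exists z.
Qed.

End NewInnerProduct.

Theorem proposition3p10 (R : realType) (A : cstarAlgType R)
    (hA : wstar_algebra A) (G : (nat -> A) -> (nat -> A))
    (hG : MPhi_minus_hat G) :
  forall K : (nat -> A) -> (nat -> A), K_l2 K ->
    exists ip : (nat -> A) -> (nat -> A) -> A,
      [/\ l2_inner_product ip,
          equivalent_ip ip (@l2_ip R A)
        & finitely_generated
            (orthogonal_complement ip (l2_closure ((G \+ K) @` @l2 R A)))].
Proof.
move=> K hK; have [m [Th [hT htail hker hgraph]]] := range_contains_graph hA hG hK.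
exists (shear_ip Th); split.
- exact: (shear_ip_inner_product hA hT htail hker).
- exact: (shear_ip_equivalent hA hT htail hker).
apply: (shear_complement_fg hA hT htail hker) => [x []|x lx tx] //.
have [w lw wE] := hgraph x lx; rewrite tx in wE.
have [T2 _ _ _] := hT; split; first by apply: l2D => //; exact: T2.
(* The graph lies in the range itself, so it is its own approximation in the closure. *)
move=> e e0; exists (x + Th x); first by exists w.
by rewrite subrr l2_normE l2n0.
Qed.
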